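(* Let $m\ge 2$ and let $k$ be a positive integer with $(k-10)(m-1)\ge 42$. Then $$\lambda_1(T_2(c_2=k-2))>\lambda_1(T_3(c_2=k-3))>\lambda_1(T_3(c_2=k-4,c_3=1))>\lambda_1(T_4(c_3=k-4))>\lambda_1(T_4(c_2=k-4))>\lambda_1(T_3(c_2=k-5,c_3=2))>\lambda_1(T_4(c_2=1,c_3=k-5)),$$ and these are the hypertrees with the first seven largest spectral radii among all $m$-uniform hypertrees with $k$ edges; that is, every $m$-uniform hypertree with $k$ edges not isomorphic to one of these seven has spectral radius strictly smaller than $\lambda_1(T_4(c_2=1,c_3=k-5))$.
   Context: A hypergraph has a finite vertex set and an edge set of non-empty subsets of the vertex set; it is $m$-uniform if all edges have cardinality $m$, and linear if two distinct edges share at most one vertex. The adjacency matrix of a linear $m$-uniform hypergraph $\mathcal{H}$ has $(i,j)$ entry $\frac{1}{m-1}$ if $i\ne j$ lie in a common edge, and $0$ otherwise; $\lambda_1(\mathcal{H})$ denotes its spectral radius. The degree of a vertex is the number of edges containing it; a vertex is pendant if its degree is one and non-pendant if its degree is larger. A loose path of length $d$, $P_L(d)=v_1e_1v_2e_2\dots v_de_dv_{d+1}$, is the $m$-uniform hypergraph with edges $e_1,\dots,e_d$ such that $e_{i-1}\cap e_i=\{v_i\}$ for $2\le i\le d$ (the $v_i$ distinct), non-consecutive edges are disjoint, and $v_1\in e_1$, $v_{d+1}\in e_d$ are pendant. A loose cycle of length $l\ge3$, $v_1e_1v_2e_2\dots v_le_lv_1$, is the $m$-uniform hypergraph with edges $e_1,\dots,e_l$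 in which cyclically consecutive edges meet exactly in $v_i$ ($e_{i-1}\cap e_i=\{v_i\}$, indices mod $l$, the $v_i$ distinct) and non-consecutive edges are disjoint. A hypertree is a connected linear hypergraph containing no loose cycle in which every edge contains at most two non-pendant vertices. Attaching a pendant edge at a vertex $v$ means adding a new edge consisting of $v$ and $m-1$ new vertices. $T_d(c_2,\dots,c_d)$ is the hypertree obtained from $P_L(d)=v_1e_1v_2\dots v_de_dv_{d+1}$ by attaching $c_i$ pendant edges at $v_i$ for $i=2,\dots,d$; when only some of the $c_i$ are listed, the others are $0$. *)

(* Defs.v *)
From HB Require Import structures.
From mathcomp Require Import classical_sets reals.
From mathcomp Require Import all_boot all_order all_algebra.
From mathcomp Require Import complex.

Set Implicit Arguments.
Unset Strict Implicit.
Unset Printing Implicit Defensive.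

Import Order.TTheory GRing.Theory Num.Theory.

Record hypergraph := Hypergraph {
  vertex :> finType;
  edges : {set {set vertex}};
  edges_nonempty : set0 \notin edges }.

Section Basics.
Variable H : hypergraph.

Definition uniform_hypergraph (m : nat) : Prop := forall e, e \in edges H -> #|e| = m.

Definition linear_hypergraph : Prop := forall e f,
  e \in edges H -> f \in edges H -> e != f -> #|e :&: f| <= 1.

Definition adjacent : rel H :=
  fun u v => (u != v) && [exists e in edges H, (u \in e) && (v \in e)].

Definition degree (v : H) : nat := #|[set e in edges H | v \in e]|.

Definition nonpendant (v : H) : bool := 1 < degree v.

Definition connected_hypergraph : Prop := forall u v : H, connect adjacent u v.

(* Indices are cyclic: [ordS] and [ord_pred] are successor and predecessor
   modulo [l].  The edges [e i] are automatically pairwise distinct. *)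
Definition has_loose_cycle : Prop :=
  exists (l : nat) (v : 'I_l -> H) (e : 'I_l -> {set H}),
    [/\ 3 <= l, injective v, forall i, e i \in edges H,
        forall i, e (ord_pred i) :&: e i = [set v i]
      & forall i j, j != i -> j != ordS i -> i != ordS j ->
          [disjoint e i & e j]].

Definition hypertree : Prop :=
  [/\ connected_hypergraph, linear_hypergraph, ~ has_loose_cycle
    & forall e, e \in edges H -> #|[set v in e | nonpendant v]| <= 2].

End Basics.

Definition uniform_hypertree (m k : nat) (H : hypergraph) : Prop :=
  [/\ uniform_hypergraph H m, hypertree H & #|edges H| = k].

Definition isomorphic (G H : hypergraph) : Prop :=
  exists2 f : G -> H, bijective f
    & [set f @: (e : {set G}) | e in edges G] = edges H.

Section SpectralRadius.
Variable R : realType.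
Local Open Scope ring_scope.
Local Open Scope classical_set_scope.

Definition spectral_radius n (A : 'M[R]_n) : R :=
  sup [set r : R | exists2 z : R[i],
         eigenvalue (map_mx (fun x : R => real_complex R x) A) z
         & r = ComplexField.Normc.normc z].

Definition adjacency (m : nat) (H : hypergraph) : 'M[R]_#|H| :=
  \matrix_(i, j)
    if adjacent (enum_val i : H) (enum_val j) then ((m - 1)%N%:R)^-1 else 0.

Definition lambda1 (m : nat) (H : hypergraph) : R :=
  spectral_radius (adjacency m H).

End SpectralRadius.

(* The vertices are 0, ..., d(m-1), and the i-th edge (1 <= i <= d) is the
   interval [(i-1)(m-1), i(m-1)] of m consecutive integers, so that for m >= 2
   the distinguished vertices are v_i = (i-1)(m-1) for 1 <= i <= d+1. *)
Section LoosePath.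
Variables m d : nat.

Definition path_pos (i : nat) : nat := (i - 1) * (m - 1).

Definition path_vertex := 'I_(d * (m - 1)).+1.

Definition path_edge (i : nat) : {set path_vertex} :=
  [set x : path_vertex | path_pos i <= x <= path_pos i.+1].

Definition path_edges : {set {set path_vertex}} :=
  [set path_edge i.+1 | i : 'I_d].

Lemma path_edges_nonempty : set0 \notin path_edges.
Proof.
apply/imsetP => -[i _ /setP E].
have lt_x : i * (m - 1) < (d * (m - 1)).+1 by rewrite ltnS leq_mul2r ltnW ?orbT.
have := E (Ordinal lt_x).
by rewrite !inE /path_pos !subn1 /= leqnn leq_mul2r leqnSn orbT.
Qed.

Definition loose_path : hypergraph := Hypergraph path_edges_nonempty.

End LoosePath.

(* [c v] pendant edges are attached at each vertex [v]; the new vertices of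
   the [j]-th of them are the [inr (Tagged _ j, t)] with [t < m - 1]. *)
Section Attach.
Variables (m : nat) (H : hypergraph) (c : H -> nat).

Definition attach_vertex : finType := (H + {v : H & 'I_(c v)} * 'I_(m - 1))%type.

Definition pendant_edge (p : {v : H & 'I_(c v)}) : {set attach_vertex} :=
  inl (tag p) |: [set inr (p, t) | t : 'I_(m - 1)].

Definition attach_edges : {set {set attach_vertex}} :=
  [set [set (inl x : attach_vertex) | x in (e : {set H})] | e in edges H]
  :|: [set pendant_edge p | p : {v : H & 'I_(c v)}].

Lemma attach_edges_nonempty : set0 \notin attach_edges.
Proof.
apply/setUP => -[] /imsetP [].
  move=> e eH /esym/eqP; rewrite imset_eq0 => /eqP e0.
  by have := edges_nonempty H; rewrite -e0 eH.
by move=> p _ /setP /(_ (inl (tag p))); rewrite !inE eqxx.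
Qed.

Definition attach_pendant : hypergraph := Hypergraph attach_edges_nonempty.

End Attach.

(* Only the values c 2, ..., c d matter: c i pendant edges go to v_i. *)
Definition Td (m d : nat) (c : nat -> nat) : hypergraph :=
  @attach_pendant m (loose_path m d)
    (fun x : path_vertex m d => \sum_(2 <= i < d.+1 | path_pos m i == x) c i).

(* Main.v *)
(* Write q = m - 1 and mu = q * lambda.  Root a hypertree at a vertex r and
   look for a positive vector x with A x = lambda x off the root.  Solving from
   the leaves upwards, the ratio of x along an edge only depends on the load
   hanging below it: if the load of a vertex v is, in units of q / s with
   s = mu - q + 1,
     l(v) = #(child edges of v) + sum over the child vertices w of g(l(w)),
     g(t) = t / (s^2 - kappa t),   kappa = (s + 1) q / (s + q),
   then x exists, and at the root the eigenvalue equation becomes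
   l(r) = mu s / q, with A x < lambda x there exactly when l(r) < mu s / q.
   Hence lambda_1 is compared with lambda by comparing a finite sum of values of
   g with mu s / q.  For the seven hypertrees, rooted at the vertex of largest
   degree, l(r) is
     k,  k-1+g(1),  k-2+g(2),  k-2+2g(1),  k-2+g(1+g(1)),  k-3+g(3),
     k-3+g(1)+g(2),
   and the hypothesis 42 <= (k - 10) q says that mu s / q <= k - 3 at s = 7, so
   that l(r) = mu s / q has a solution s >= 7, where g is small and convex enough
   for all comparisons. For another hypertree: if some degree D is in [5,
   k-4], convexity of g bounds the load by that of the double broom, D + g(k -
   D); if all degrees are at most 4, all loads below the root are at most 4;
   and if some degree is at least k-3, at most three edges avoid that vertex
   and only finitely many shapes remain. *)
Require Import Defs.
From Stdlib Require Import List.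
From mathcomp Require Import classical_sets reals topology normedtype.
From mathcomp Require Import all_boot all_order all_algebra zify ring lra.
From mathcomp Require Import complex.

Set Implicit Arguments.
Unset Strict Implicit.
Unset Printing Implicit Defensive.

Import Order.TTheory GRing.Theory Num.Theory.

(** * Loose cycles and rootings *)

(** An edge has at most two nonpendant vertices, and under a nonpendant root its top is one of them;
    so at most one vertex below the top carries a nonzero load, and elimination along an edge is a
    function of one variable. The obstacle is that this function has a pole: the recursion yields a
    positive vector only while every load [t] below the root keeps [s ^ 2 - kappa t] positive, and
    this must be known at the chosen [s] before anything is known about the spectral radius. The
    identity [s ^ 2 = 1 + kappa (c - 1)], with [c] the critical load mu s / q, supplies it: up to
    [c - 1] the denominator is at least 1, so g(t) <= t, and a load is at most the number of edges
    hanging below its vertex. A root of degree at least 5 leaves at most [k - 5] of them, which is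
    less than [c - 1] as soon as [c >= k - 3]. When all degrees are at most 4, the bound reproduces
    itself instead: gains of loads up to 4 are at most 1/3, and three child edges of weight at most
    4/3 again give at most 4. *)

Definition linked (H : hypergraph) (v : H) (e f : {set H}) : bool :=
  [exists x, [&& x != v, x \in e & x \in f]].

Lemma linkedP (H : hypergraph) (v : H) (e f : {set H}) :
  reflect (exists x, [/\ x != v, x \in e & x \in f]) (linked v e f).
Proof. by apply: (iffP existsP) => -[x /and3P]; exists x. Qed.

Lemma linear_eq (H : hypergraph) (e f : {set H}) x y : linear_hypergraph H ->
  e \in edges H -> f \in edges H -> x \in e -> x \in f -> y \in e -> y \in f ->
  x != y -> e = f.
Proof.
move=> lin eE fE xe xf ye yf xy; apply/eqP/negPn/negP => nef.
have: 1 < #|e :&: f|.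
  apply/card_gt1P; exists x, y; split=> //; rewrite ?inE ?xe ?xf ?ye ?yf //.
by rewrite ltnNge lin.
Qed.

(* A shortest closed chain of edges through [v] is a loose cycle. *)
Lemma closed_walk_loose_cycle (H : hypergraph) (v : H) n (g : nat -> {set H}) :
  linear_hypergraph H -> (forall i, i <= n -> g i \in edges H) ->
  v \in g 0 -> v \in g n -> g 0 != g n ->
  (forall i, i < n -> linked v (g i) (g i.+1)) -> has_loose_cycle H.
Proof.
move=> lin; move: n g; elim/ltn_ind => n IH g gE v0 vn g0n lk.
(* Strong induction on the length: a walk that is not yet minimal is cut. If an inner edge [g i]
   passes through [v], one of the two pieces still has distinct end edges. *)
have [/existsP[i /andP[i0 vi]]|noA] :=
  boolP [exists i : 'I_n, (0 < i) && (v \in g i)].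
  have ltin := ltn_ord i.
  have [gi0|gi0] := eqVneq (g i) (g 0).
  - apply: (IH (n - i) _ (fun t => g (t + i))) => //.
    + by lia.
    + by move=> t ht; apply: gE; lia.
    + by rewrite subnK // ltnW.
    + by rewrite add0n gi0 subnK // ltnW.
    + by move=> t ht; rewrite addSn; apply: lk; lia.
  - apply: (IH i _ g) => //.
    + by move=> t ht; apply: gE; lia.
    + by rewrite eq_sym.
    + by move=> t ht; apply: lk; lia.
have {}noA i : 0 < i < n -> v \notin g i.
  case/andP=> i0 iN; apply/negP => vi; case/negP: noA.
  by apply/existsP; exists (Ordinal iN); rewrite /= i0.
(* An edge repeated in succession is dropped; a link between non-consecutive edges, treated next, is
   a shortcut. *)
have [/existsP[i /eqP gi]|noB] := boolP [exists i : 'I_n, g i == g i.+1].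
  have ltin := ltn_ord i.
  have gpn : (if n.-1 <= i then g n.-1 else g n.-1.+1) = g n.
    case: ifP => hi; last by congr g; lia.
    have -> : n.-1 = i by lia.
    by rewrite gi; congr g; lia.
  apply: (IH n.-1 _ (fun t => if t <= i then g t else g t.+1)) => //.
  + by lia.
  + by move=> t ht; case: ifP => _; apply: gE; lia.
  + by rewrite gpn.
  + by rewrite /= gpn.
  + move=> t ht; case: (ltngtP t i) => hti.
    * by apply: lk; lia.
    * by apply: lk; lia.
    * by rewrite hti gi; apply: lk; lia.
have {}noB i : i < n -> g i != g i.+1.
  move=> iN; apply/negP => /eqP gi; case/negP: noB.
  by apply/existsP; exists (Ordinal iN); rewrite /= gi.
have [/existsP[i /existsP[j /andP[ij lij]]]|noC] :=
  boolP [exists i : 'I_n.+1, exists j : 'I_n.+1,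
          (i.+1 < j) && linked v (g i) (g j)].
  have ltin := ltn_ord i; have ltjn := ltn_ord j.
  apply: (IH (n - (j - i.+1)) _
            (fun t => if t <= i then g t else g (t + (j - i.+1)))) => //.
  + by lia.
  + by move=> t ht; case: ifP => _; apply: gE; lia.
  + by case: ifP => hi; [lia|rewrite subnK //; lia].
  + by rewrite /=; case: ifP => hi; [lia|rewrite subnK //; lia].
  + move=> t ht; case: (ltngtP t i) => hti.
    * by apply: lk; lia.
    * by rewrite addSn; apply: lk; lia.
    * by rewrite hti (_ : i.+1 + _ = j) //; lia.
have {}noC i j : i.+1 < j -> j <= n -> ~~ linked v (g i) (g j).
  move=> ij jn; apply/negP => lij; case/negP: noC.
  have iN : i < n.+1 by lia.
  have jN : j < n.+1 by lia.
  apply/existsP; exists (Ordinal iN); apply/existsP; exists (Ordinal jN).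
  by rewrite /= ij.
have n2 : 2 <= n.
  case: n IH gE vn g0n lk noA noB noC => [|[|n]] // IH gE vn g0n lk _ _ _.
    by rewrite eqxx in g0n.
  have /linkedP[x [xv x0 x1]] := lk 0 isT.
  have := linear_eq lin (gE 0 isT) (gE 1 isT) x0 x1 v0 vn xv.
  by move=> E; rewrite E eqxx in g0n.
(* The joints of the cycle: [v] closes it, and [w i.+1] is a common vertex of [g i] and [g i.+1]
   other than [v]. *)
pose w i := if i is i'.+1
  then odflt v [pick x | [&& x != v, x \in g i' & x \in g i]] else v.
have wP i : i < n -> [/\ w i.+1 != v, w i.+1 \in g i & w i.+1 \in g i.+1].
  move=> iN; rewrite /w; case: pickP => [x /and3P[] //|].
  by have /linkedP[x [xv x0 x1]] := lk i iN; move=> /(_ x); rewrite xv x0 x1.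
have disj i j : i.+1 < j -> j <= n -> ~~ ((i == 0) && (j == n)) -> [disjoint g i & g j].
  move=> ij jn ends; apply/pred0P => x /=; apply/negP => /andP[xi xj].
  have [xv|xv] := eqVneq x v.
    subst x.
    have [i0|i0] := posnP i.
      have : j < n by rewrite ltn_neqAle jn andbT; move: ends; rewrite i0.
      by move=> jN; have := noA j; rewrite xj jN; lia.
    by have := noA i; rewrite i0 xi; lia.
  by case/negP: (noC i j ij jn); apply/linkedP; exists x.
exists n.+1, (fun i => w i), (fun i => g i); split=> //.
- suff inj i j : i < j -> j <= n -> w i != w j.
    move=> i j /= wij; apply/val_inj; have := ltn_ord i; have := ltn_ord j.
    case: (ltngtP i j) => // ij jn iN.
      by have := inj i j ij; rewrite wij eqxx => /(_ jn).
    by have := inj j i ij; rewrite wij eqxx => /(_ iN).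
  case: j => // j ij jn; have [wv wj wj1] := wP j jn.
  case: i ij => [|i] ij; first by rewrite eq_sym.
  have [wiv wi wi1] := wP i (leq_trans (ltnW ij) jn).
  apply/negP => /eqP E; have /noC/(_ jn)/negP[] : i.+1 < j.+1 by [].
  by apply/linkedP; exists (w j.+1); rewrite -{2}E.
- by move=> i; apply: gE; rewrite -ltnS.
- move=> i; apply/setP => x; rewrite !inE.
  have iN : i <= n by rewrite -ltnS.
  suff gp : [/\ g (ord_pred i) \in edges H, g i \in edges H,
            g (ord_pred i) != g i, w i \in g (ord_pred i) & w i \in g i].
    case: gp => pE iE npi wp wi.
    apply/andP/eqP => [[xp xi]|->//]; apply/eqP/negPn/negP => xw.
    by case/negP: npi; apply/eqP; apply: (linear_eq lin pE iE xp xi wp wi xw).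
  case: i iN => i /= iN' iN.
  case: i iN iN' => [|i] iN iN'.
    by rewrite add0n /= modn_small // gE // gE // eq_sym g0n.
  have [wv wj wj1] := wP i iN.
  have -> : (i.+1 + n.+1).-1 %% n.+1 = i by rewrite addSn /= modnDr modn_small //; lia.
  by split=> //; [apply: gE; lia|apply: gE; lia|apply: noB].
- move=> i j ij jSi iSj.
  have {}ij : nat_of_ord i != nat_of_ord j by rewrite eq_sym.
  have {}jSi : nat_of_ord j != i.+1 %% n.+1 by [].
  have {}iSj : nat_of_ord i != j.+1 %% n.+1 by [].
  move: (nat_of_ord i) (nat_of_ord j) (ltn_ord i) (ltn_ord j) ij jSi iSj.
  move=> {}i {}j iN jN ij jSi iSj.
  wlog lij : i j iN jN ij jSi iSj / i < j.
    move=> W; case: (ltngtP i j) ij => // ltij _; first by apply: W => //; lia.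
    by rewrite disjoint_sym; apply: W => //; lia.
  have hj : j != i.+1 by move: jSi; rewrite modn_small //; lia.
  apply: disj; [lia|lia|].
  by apply/negP => /andP[/eqP i0 /eqP jn]; move: iSj; rewrite jn modnn i0.
Qed.

Lemma adjacent_sym (H : hypergraph) : symmetric (@adjacent H).
Proof.
move=> u v; rewrite /adjacent eq_sym; congr (_ && _).
by apply: eq_existsb => e; rewrite andbA andbAC -andbA [(v \in e) && _]andbC.
Qed.

Lemma adjacentP (H : hypergraph) (u v : H) :
  reflect (exists e, [/\ u != v, e \in edges H, u \in e & v \in e])
    (adjacent u v).
Proof.
apply: (iffP andP) => [[uv /existsP[e /and3P[eE ue ve]]]|[e [uv eE ue ve]]].
  by exists e.
by split=> //; apply/existsP; exists e; rewrite eE ue ve.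
Qed.

Definition adjacent_off (H : hypergraph) (v : H) : rel H :=
  fun x y => [&& adjacent x y, x != v & y != v].

Lemma off_path_walk (H : hypergraph) (v : H) s u (e f : {set H}) :
  path (adjacent_off v) u s -> e \in edges H -> u \in e -> u != v ->
  f \in edges H -> last u s \in f ->
  exists n (g : nat -> {set H}), [/\ g 0 = e, g n = f,
    forall i, i <= n -> g i \in edges H
    & forall i, i < n -> linked v (g i) (g i.+1)].
Proof.
elim: s u e => [|x s IH] u e /=.
  move=> _ eE ue uv fE uf.
  exists 1, (fun i => if i is 0 then e else f); split=> // [[|i]|[|i]] //.
  by move=> _; apply/linkedP; exists u.
case/andP=> /and3P[/adjacentP[h [ux hE uh xh]] _ xv] ps eE ue uv fE lf.
have [n [g [g0 gn gE gl]]] := IH x h ps hE xh xv fE lf.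
exists n.+1, (fun i => if i is i'.+1 then g i' else e); split=> // [[|i]|[|i]] //.
- by apply: gE.
- by move=> _; apply/linkedP; exists u; rewrite g0.
- by apply: gl.
Qed.

(** Otherwise the path avoiding [v], together with the two edges at [v], would be a closed chain and
    hence contain a loose cycle: different edges at [v] fall into different components once [v] is
    removed. *)
Lemma hypertree_separation (H : hypergraph) (v : H) (e f : {set H}) u w :
  hypertree H -> e \in edges H -> f \in edges H -> v \in e -> v \in f ->
  u \in e -> w \in f -> u != v -> w != v -> connect (adjacent_off v) u w ->
  e = f.
Proof.
case=> _ lin nocycle _ eE fE ve vf ue wf uv wv /connectP[s ps lw].
apply/eqP/negPn/negP => ef; apply: nocycle; rewrite lw in wf.
have [n [g [g0 gn gE gl]]] := off_path_walk ps eE ue uv fE wf.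
by apply: (closed_walk_loose_cycle (v := v) (n := n) (g := g)); rewrite ?g0 ?gn.
Qed.

Lemma distance_exists (H : hypergraph) (r : H) : connected_hypergraph H ->
  exists d : H -> nat, [/\ d r = 0,
    forall u v, adjacent u v -> d v <= (d u).+1
    & forall v, v != r -> exists2 u, adjacent u v & d v = (d u).+1].
Proof.
move=> con.
pose ball := fix ball n : {set H} := if n is n'.+1
  then ball n' :|: [set v | [exists u in ball n', adjacent u v]] else [set r].
have ballS n u v : u \in ball n -> adjacent u v -> v \in ball n.+1.
  by move=> un uv; rewrite !inE; apply/orP; right; apply/existsP; exists u; rewrite un.
have ex v : exists n, v \in ball n.
  have /connectP[s ps ->] := con r v.
  suff walk n u : u \in ball n -> path (@adjacent H) u s -> last u s \in ball (n + size s).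
    by exists (0 + size s); apply: walk; rewrite ?inE.
  elim: s {ps} n u => [|x s IH] n u un /=; first by rewrite addn0.
  by case/andP=> ux ps; rewrite -addSnnS; apply: IH => //; apply: ballS ux.
exists (fun v => ex_minn (ex v)); split.
- by case: ex_minnP => n _ /(_ 0); rewrite inE eqxx leqn0 => /(_ isT)/eqP.
- move=> u v uv; case: ex_minnP => n vn nmin; case: ex_minnP => k uk _.
  by apply: nmin; apply: ballS uv.
- move=> v vr; case: ex_minnP => -[|n].
    by rewrite inE (negPf vr).
  rewrite !inE => /orP[vn /(_ n vn)|/existsP[u /andP[un uv]] nmin].
    by rewrite ltnn.
  exists u => //; case: ex_minnP => k uk kmin.
  by apply/eqP; rewrite eqSS eqn_leq kmin // andbT -ltnS; apply: nmin; apply: ballS uv.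
Qed.

(* [top e] is the vertex of [e] nearest the root [r], and [up w] the edge at [w]
   leading towards [r]; the values at non-edges and at [r] itself are junk. *)
Record rooting (H : hypergraph) (r : H) := Rooting {
  top : {set H} -> H;
  up : H -> {set H};
  depth : H -> nat;
  top_in : forall e, e \in edges H -> top e \in e;
  depth_below : forall e w,
    e \in edges H -> w \in e -> w != top e -> depth w = (depth (top e)).+1;
  up_below : forall e w, e \in edges H -> w \in e -> w != top e -> up w = e;
  depth_root : depth r = 0;
  up_edge : forall w, w != r -> up w \in edges H;
  in_up : forall w, w != r -> w \in up w;
  top_up_neq : forall w, w != r -> w != top (up w) }.

(** Two vertices other than [v] and no farther from the root than [v] are joined by a path avoiding
    [v]. By separation only one edge at [v] can contain such vertices, and that edge is [up v]. *)
Lemma hypertree_rooting (H : hypergraph) (r : H) :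
  hypertree H -> inhabited (rooting r).
Proof.
move=> tree; have [con _ _ _] := tree.
have [d [dr d_adj d_pred]] := distance_exists r con.
(* After its start, a descending path from [u] to [r] visits only distances below [d v], so it
   avoids [v]. *)
have toroot u v : u != v -> d u <= d v -> connect (adjacent_off v) u r.
  have [n] := ubnP (d u); elim: n u => // n IH u dun uv duv.
  have [->|ur] := eqVneq u r; first exact: connect0.
  have [u' u'u du] := d_pred u ur.
  have u'v : u' != v by apply/eqP => E; move: duv; rewrite du E ltnn.
  apply: connect_trans (IH u' _ u'v _).
  - by apply: connect1; rewrite /adjacent_off adjacent_sym u'u uv u'v.
  - by rewrite -ltnS -du.
  - by rewrite ltnW // -du.
have off_sym v : connect_sym (adjacent_off v).
  apply: sym_connect_sym => x y.
  by rewrite /adjacent_off adjacent_sym [(y != v) && _]andbC.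
have sep e f v u w : e \in edges H -> f \in edges H -> v \in e -> v \in f ->
    u \in e -> w \in f -> u != v -> w != v -> d u <= d v -> d w <= d v -> e = f.
  move=> eE fE ve vf ue wf uv wv du dw.
  apply: (hypertree_separation tree eE fE ve vf ue wf uv wv).
  by apply: (connect_trans (toroot u v uv du)); rewrite off_sym; apply: toroot.
pose top (e : {set H}) := odflt r [pick u in e | [forall x in e, d u <= d x]].
have topP e : e \in edges H -> top e \in e /\ forall x, x \in e -> d (top e) <= d x.
  move=> eE; rewrite /top; case: pickP => [u /andP[ue /forall_inP]|none] //.
  have /set0Pn[x0 x0e] : e != set0.
    by apply/eqP => e0; have := edges_nonempty H; rewrite -e0 eE.
  case: (arg_minnP d x0e) => u ue umin.
  by move: (none u) => /negP[]; apply/andP; split=> //; apply/forall_inP.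
have below e w : e \in edges H -> w \in e -> w != top e -> d w = (d (top e)).+1.
  move=> eE we wt; have [te tmin] := topP e eE.
  have adj : adjacent (top e) w by apply/adjacentP; exists e; rewrite eq_sym.
  apply/eqP; rewrite eqn_leq d_adj //= ltn_neqAle tmin // andbT.
  (* On a tie, the edge [g] leading from [top e] towards [r] would equal [e] by [sep], although [g]
     contains a vertex strictly nearer to [r]. *)
  apply/eqP => dtw.
  have [tr|tr] := eqVneq (top e) r.
    have [u _] : exists2 u, adjacent u w & d w = (d u).+1.
      by apply: d_pred; rewrite -tr.
    by rewrite -dtw tr dr.
  have [u /adjacentP[g [ut gE ug tg]] du] := d_pred _ tr.
  have eg : e = g.
    by apply: (sep e g (top e) w u) => //; rewrite ?dtw // -dtw du.
  by have := tmin u; rewrite eg ug -eg du ltnn => /(_ isT).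
pose up w := odflt set0 [pick e in edges H | (w \in e) && (w != top e)].
have upP w : w != r -> [/\ up w \in edges H, w \in up w & w != top (up w)].
  move=> wr; rewrite /up; case: pickP => [e /and3P[]|none] //.
  have [u /adjacentP[g [uw gE ug wg]] dw] := d_pred w wr.
  move: (none g) => /negP[]; rewrite /= gE wg /=; apply/eqP => wt.
  by have [_ /(_ u ug)] := topP g gE; rewrite -wt dw ltnn.
constructor; exists top up d => //.
- by move=> e /topP[].
- move=> e w eE we wt.
  have wr : w != r by apply/eqP => E; have := below e w eE we wt; rewrite E dr.
  have [uE wu wtu] := upP w wr.
  apply: (sep _ _ w (top (up w)) (top e)) => //; rewrite 1?eq_sym //.
  + by have [] := topP _ uE.
  + by have [] := topP _ eE.
  + by rewrite (below _ w uE).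
  + by rewrite (below _ w eE).
- by move=> w /upP[].
- by move=> w /upP[].
- by move=> w /upP[].
Qed.

(** * A rooting forces linearity, connectedness and acyclicity *)

Section RootedTheory.
Variables (H : hypergraph) (r : H) (T : rooting r).

Lemma depth_gt0_neq w : 0 < depth T w -> w != r.
Proof. by apply: contraTneq => ->; rewrite depth_root. Qed.

Lemma below_neq_root e w :
  e \in edges H -> w \in e -> w != top T e -> w != r.
Proof. by move=> eE we wt; apply: depth_gt0_neq; rewrite (depth_below eE we wt). Qed.

Lemma top_root e : e \in edges H -> r \in e -> top T e = r.
Proof.
move=> eE re; apply/eqP/negPn/negP => tr.
by have := below_neq_root eE re; rewrite eq_sym tr eqxx => /(_ isT).
Qed.

Lemma edge_top_or_up e w : e \in edges H -> w \in e -> w = top T e \/ up T w = e.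
Proof.
move=> eE we; have [->|wt] := eqVneq w (top T e); first by left.
by right; apply: up_below.
Qed.

(** A common vertex that is the top of neither edge determines both through [up]. So two common
    vertices of distinct edges would be the two tops, each lying one level below the other. *)
Lemma rooting_linear : linear_hypergraph H.
Proof.
move=> e f eE fE ef; rewrite leqNgt; apply/negP.
case/card_gt1P=> x [y []]; rewrite !inE => /andP[xe xf] /andP[ye yf] xy.
have [xe'|xe'] := edge_top_or_up eE xe; have [xf'|xf'] := edge_top_or_up fE xf;
have [ye'|ye'] := edge_top_or_up eE ye; have [yf'|yf'] := edge_top_or_up fE yf;
  try by [rewrite xe' ye' eqxx in xy|rewrite xf' yf' eqxx in xy
         |rewrite -xe' xf' eqxx in ef|rewrite -ye' yf' eqxx in ef].
- have := @depth_below _ _ T _ _ eE ye; rewrite -xe' eq_sym => /(_ xy).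
  have := @depth_below _ _ T _ _ fE xf; rewrite -yf' => /(_ xy).
  by move=> -> /eqP; rewrite -[X in X == _]addn0 -addn2 eqn_add2l.
- have := @depth_below _ _ T _ _ fE yf; rewrite -xf' eq_sym => /(_ xy).
  have := @depth_below _ _ T _ _ eE xe; rewrite -ye' => /(_ xy).
  by move=> -> /eqP; rewrite -[X in X == _]addn0 -addn2 eqn_add2l.
Qed.

Lemma rooting_connected : connected_hypergraph H.
Proof.
have sym : connect_sym (@adjacent H) by apply/sym_connect_sym/adjacent_sym.
suff toroot u : connect (@adjacent H) u r.
  by move=> u v; apply: (connect_trans (toroot u)); rewrite sym.
have [n] := ubnP (depth T u); elim: n u => // n IH u dun.
have [->|ur] := eqVneq u r; first exact: connect0.
have uE := up_edge T ur; have uu := in_up T ur; have ut := top_up_neq T ur.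
apply: (connect_trans (y := top T (up T u))).
  by apply/connect1/adjacentP; exists (up T u); split=> //; apply: top_in.
by apply: IH; rewrite -ltnS -(depth_below uE uu ut).
Qed.

(** At a deepest joint of the cycle neither cycle edge has that joint as its top, since the other
    joint on the edge would be deeper; both edges then equal [up] of the joint. *)
Lemma rooting_acyclic : ~ has_loose_cycle H.
Proof.
case=> l [v [e [l3 vinj eE ev _]]].
have vin i : v i \in e (ord_pred i) /\ v i \in e i.
  by apply/andP; rewrite -in_setI ev inE.
have [i imax] : exists i : 'I_l, forall j, depth T (v j) <= depth T (v i).
  have i0 : 'I_l by apply: (@Ordinal l 0); apply: leq_trans l3.
  case: (arg_maxnP (fun i => depth T (v i)) (isT : xpredT i0)) => i _ imax.
  by exists i => j; apply: imax.
have notop j k : v j \in e k -> v i \in e k -> j != i -> v i != top T (e k).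
  move=> jk ik ji; apply/eqP => vt.
  have := imax j; rewrite (@depth_below _ _ T _ _ (eE k) jk); first by rewrite -vt ltnn.
  by rewrite -vt; apply: contra ji => /eqP/vinj->.
have [vp vi] := vin i.
have l1 : 1 < l by apply: leq_trans l3.
have Spred (j : 'I_l) : (ordS j != j) * (ord_pred j != j).
  have jl := ltn_ord j.
  have -> : ordS j != j.
    rewrite -val_eqE /=; have [h|h] : j.+1 < l \/ j.+1 = l by lia.
      by rewrite modn_small //; lia.
    by rewrite h modnn; lia.
  have -> // : ord_pred j != j.
  rewrite -val_eqE /=; case: (posnP j) => [->|j0].
    by rewrite add0n modn_small; lia.
  have -> : (j + l).-1 = j.-1 + l by lia.
  by rewrite modnDr modn_small; lia.
have u1 : up T (v i) = e i.
  apply: up_below => //; apply: (notop (ordS i)) => //; last by rewrite Spred.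
  by have [] := vin (ordS i); rewrite ordSK.
have u2 : up T (v i) = e (ord_pred i).
  apply: up_below => //; apply: (notop (ord_pred i)) => //; last by rewrite Spred.
  by have [] := vin (ord_pred i).
have [p1 p2] := vin (ordS i).
have [q1 q2] := vin (ord_pred i).
have E : e (ord_pred i) = e i by rewrite -u1 -u2.
have : v (ord_pred i) \in [set v i] by rewrite -ev E setIid -E.
by rewrite inE => /eqP/vinj/eqP; rewrite (negPf (Spred i).2).
Qed.

End RootedTheory.

(** * Loads on rooted hypertrees *)

Section Loads.
Variables (H : hypergraph) (r : H) (T : rooting r).

Definition parent (v : H) : H := top T (up T v).

Definition children (v : H) : nat := #|[set e in edges H | top T e == v]|.

Lemma depth_parent w : w != r -> depth T w = (depth T (parent w)).+1.
Proof. by move=> wr; apply: depth_below (up_edge T wr) (in_up T wr) (top_up_neq T wr). Qed.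

Lemma rooting_ind (P : H -> Prop) :
  (forall v, (forall w, w != r -> parent w = v -> P w) -> P v) -> forall v, P v.
Proof.
move=> step v; pose N := \max_(u : H) depth T u.
have leN u : depth T u <= N by apply: leq_bigmax.
have [n] := ubnP (N - depth T v); elim: n v => // n IH v dvn.
apply: step => w wr wv; apply: IH.
by have := leN w; rewrite depth_parent // wv; move: dvn; lia.
Qed.

Lemma edges_at_vertex v : [set e in edges H | v \in e] =
  (if v == r then set0 else [set up T v]) :|: [set e in edges H | top T e == v].
Proof.
apply/setP => e; rewrite !inE; have [-> |vr] := eqVneq v r; rewrite !inE.
  apply/andP/andP => [[eE re]|[eE /eqP <-]]; split=> //; last exact: top_in.
  by rewrite (top_root T).
apply/andP/orP => [[eE ve]|[/eqP ->|/andP[eE /eqP <-]]].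
- have [->|vt] := eqVneq v (top T e); first by right; rewrite eE ?eqxx.
  by left; rewrite (up_below eE ve vt).
- by rewrite up_edge // in_up.
- by rewrite eE top_in.
Qed.

Lemma sum_edges_at_vertex (V : nmodType) (F : {set H} -> V) v :
  (\sum_(e in edges H | v \in e) F e =
   (if v == r then 0 else F (up T v)) + \sum_(e in edges H | top T e == v) F e)%R.
Proof.
rewrite -[LHS]big_set edges_at_vertex.
transitivity (\sum_(e in [predU (if v == r then set0 else [set up T v])
    & [set e in edges H | top T e == v]]) F e)%R.
  by apply: eq_bigl => e; rewrite !inE.
rewrite bigU /=.
- by rewrite big_set; congr (_ + _)%R; case: ifP => _; rewrite ?big_set0 ?big_set1.
- apply/pred0P => e /=; apply/negP; rewrite [X in _ && X]inE.
  case/andP=> ev /andP[eE /eqP tv]; move: ev; have [_|vr] := eqVneq v r; rewrite inE //.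
  by move=> /eqP E; have := top_up_neq T vr; rewrite -E tv eqxx.
Qed.

Lemma degree_children v : degree v = (v != r) + children v.
Proof.
rewrite /degree /children -!sum1_card.
transitivity (\sum_(e in edges H | v \in e) 1).
  by apply: eq_bigl => e; rewrite inE.
rewrite (@sum_edges_at_vertex nat); congr (_ + _); first by case: eqVneq.
by apply: eq_bigl => e; rewrite inE.
Qed.

Lemma sum_children : \sum_v children v = #|edges H|.
Proof.
rewrite -sum1_card (partition_big (top T) xpredT) //=; apply: eq_bigr => v _.
by rewrite /children -sum1_card; apply: eq_bigl => e; rewrite inE.
Qed.

Lemma sum_below (V : nmodType) (F : H -> V) v :
  (\sum_(e in edges H | top T e == v) \sum_(w in e :\ top T e) F w =
   \sum_(w | (w != r) && (parent w == v)) F w)%R.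
Proof.
rewrite [RHS](partition_big (up T) (fun e => (e \in edges H) && (top T e == v)));
  last by move=> w /andP[wr wv]; rewrite up_edge.
apply: eq_bigr => e /andP[eE /eqP tv]; apply: eq_bigl => w; rewrite !inE.
apply/andP/andP => [[wt we]|[/andP[wr _] /eqP <-]]; last first.
  by rewrite top_up_neq // in_up.
by rewrite /parent (up_below eE we wt) tv (below_neq_root eE we wt) !eqxx.
Qed.

Section Recursion.
Variable S : pzSemiRingType.
Local Open Scope ring_scope.

(** [gain] for [g] gives the spectral load, [id] the number of edges hanging below [v], which serves
    as its bound. Pendant vertices other than the root have load 0, so they add nothing when
    [g 0 = 0]. *)
Definition is_load (g : S -> S) (l : H -> S) : Prop := forall v,
  l v = \sum_(e in edges H | top T e == v) (1 + \sum_(w in e :\ top T e) g (l w)).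

Lemma load_exists (g : S -> S) : exists l, is_load g l.
Proof.
(* Recursion on fuel: [N - depth v] steps suffice at [v], because children are exactly one level
   deeper. *)
pose L := fix L n v : S := if n is n'.+1
  then \sum_(e in edges H | top T e == v) (1 + \sum_(w in e :\ top T e) g (L n' w))
  else 0.
pose N := (\max_(u : H) depth T u).+1.
have leN u : (depth T u < N)%N by apply: leq_bigmax.
exists (fun v => L (N - depth T v)%N v) => v /=.
have -> : (N - depth T v)%N = (N - (depth T v).+1).+1 by have := leN v; lia.
apply: eq_bigr => e /andP[eE /eqP tv]; congr (_ + _); apply: eq_bigr => w.
by rewrite !inE => /andP[wt we]; rewrite (depth_below eE we wt) tv.
Qed.

Lemma loadE g l v : is_load g l ->
  l v = (children v)%:R + \sum_(w | (w != r) && (parent w == v)) g (l w).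
Proof.
move=> ->; rewrite big_split /= sum_below; congr (_ + _).
rewrite sumr_const; congr (_ *+ _).
by apply: eq_card => e; rewrite inE.
Qed.

End Recursion.

Hypothesis root_nonpendant : nonpendant r.

Lemma top_nonpendant e : e \in edges H -> nonpendant (top T e).
Proof.
move=> eE; have [-> //|tr] := eqVneq (top T e) r.
rewrite /nonpendant degree_children tr add1n ltnS card_gt0.
by apply/set0Pn; exists e; rewrite inE eE eqxx.
Qed.

Hypothesis two_nonpendant :
  forall e, e \in edges H -> #|[set v in e | nonpendant v]| <= 2.

(** The top is nonpendant and takes one of the two places that an edge allows. *)
Lemma nonpendant_below_unique e u w : e \in edges H ->
  u \in e :\ top T e -> w \in e :\ top T e -> nonpendant u -> nonpendant w ->
  u = w.
Proof.
move=> eE; rewrite !inE => /andP[ut ue] /andP[wt we] un wn.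
apply/eqP/negPn/negP => uw; have := two_nonpendant eE; rewrite leqNgt => /negP[].
apply/card_gt2P; exists (top T e), u, w; rewrite !inE ue we un wn.
by rewrite top_in // top_nonpendant // uw wt (eq_sym _ u) ut.
Qed.

Lemma children_pendant w : w != r -> ~~ nonpendant w -> children w = 0.
Proof. by rewrite /nonpendant degree_children => ->; case: (children w). Qed.

Lemma no_child_of_pendant w v : w != r -> ~~ nonpendant w ->
  ~~ ((v != r) && (parent v == w)).
Proof.
move=> wr wp; apply/negP => /andP[vr /eqP pv]; case/negP: wp; rewrite -pv.
by apply: top_nonpendant; apply: up_edge.
Qed.

Lemma load_pendant (S : pzSemiRingType) (g : S -> S) l w :
  is_load g l -> w != r -> ~~ nonpendant w -> l w = 0%R.
Proof.
move=> lP wr wp; rewrite (loadE w lP) children_pendant // add0r big1 // => v.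
by move/negPf: (no_child_of_pendant v wr wp) => ->.
Qed.

Lemma below_cases e : e \in edges H ->
  {c | c \in e :\ top T e /\ nonpendant c} +
  {forall w, w \in e :\ top T e -> ~~ nonpendant w}.
Proof.
move=> eE; case: (pickP [pred c | (c \in e :\ top T e) && nonpendant c]).
  by move=> c /andP[]; left; exists c.
by move=> none; right => w we; have := none w; rewrite /= we /= => ->.
Qed.

End Loads.

(** * Loads for the identity gain: counting edges below a vertex *)

Section NatLoad.
Variables (R : realFieldType) (H : hypergraph) (r : H) (T : rooting r).
Variable n : H -> R.
Hypothesis nP : is_load T id n.
Local Open Scope ring_scope.

Lemma size_ge0 v : 0 <= n v.
Proof.
move: v; apply: (@rooting_ind _ _ T) => v IH; rewrite (loadE v nP) addr_ge0 //.
by apply: sumr_ge0 => w /andP[wr /eqP pw]; apply: IH.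
Qed.

(** Summed over all vertices, the recursion counts each edge once, at its top, and each non-root
    value once, at its parent; the non-root values cancel. *)
Lemma size_root : n r = #|edges H|%:R.
Proof.
have : \sum_v n v = #|edges H|%:R + \sum_(w | w != r) n w.
  transitivity (\sum_v ((children T v)%:R +
      \sum_(w | (w != r) && (parent T w == v)) n w)).
    by apply: eq_bigr => v _; exact: (loadE v nP).
  rewrite big_split /= -natr_sum sum_children; congr (_ + _).
  by rewrite [RHS](partition_big (parent T) xpredT).
by rewrite (bigD1 r) //= => /addIr.
Qed.

(** The edges counted by [n w] do not contain [r], so they are disjoint from the edges at the
    root. *)
Lemma size_below w : w != r -> (degree r)%:R + n w <= #|edges H|%:R.
Proof.
have [d] := ubnP (depth T w); elim: d w => // d IH w dw wr.
have le_par : (children T (parent T w))%:R + n w <= n (parent T w).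
  rewrite [leRHS](loadE _ nP) lerD2l (bigD1 w) ?wr ?eqxx //=.
  by rewrite lerDl sumr_ge0 // => u _; apply: size_ge0.
have [pr|pr] := eqVneq (parent T w) r.
  by rewrite -size_root -{2}pr; move: le_par; rewrite pr (degree_children T) eqxx.
apply: le_trans (IH (parent T w) _ pr); last first.
  by move: dw; rewrite depth_parent.
by rewrite lerD2l (le_trans _ le_par) // lerDr.
Qed.

End NatLoad.

(** * Bounding the spectral radius by test vectors *)

Section PerronBounds.
Variables (R : realType) (H : hypergraph).
Local Open Scope ring_scope.
Implicit Types (x y : H -> R) (c t : R).

Definition nbr_sum x v := \sum_(u | adjacent v u) x u.

(** Collatz-Wielandt comparison at a vertex where [y / x] is largest. If [t = c], maximality of the
    ratio spreads to all neighbours, so on a connected hypergraph [y] is a multiple of [x] and the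
    inequality for [x] is nowhere strict. *)
Lemma nonneg_subeigen_le x y c t : (forall v, 0 < x v) ->
  (forall v, nbr_sum x v <= c * x v) ->
  (forall v, 0 <= y v) -> (exists v, y v != 0) ->
  (forall v, t * y v <= nbr_sum y v) ->
  t <= c /\ (connected_hypergraph H -> (exists v, nbr_sum x v < c * x v) -> t < c).
Proof.
move=> x0 xc y0 [v0 yv0] yt.
pose q v := y v / x v.
case: (@arg_maxP _ _ _ v0 predT q isT) => w _ wmax'.
have {wmax'}wmax v : q v <= q w by apply: wmax'.
have qx v : q v * x v = y v by rewrite divfK // gt_eqF.
have yle v : y v <= q w * x v by rewrite -qx ler_pM2r.
have qw0 : 0 < q w.
  apply: lt_le_trans (wmax v0); rewrite /q divr_gt0 //.
  by rewrite lt_neqAle eq_sym yv0 y0.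
have sum_le v : nbr_sum y v <= q w * nbr_sum x v.
  by rewrite mulr_sumr; apply: ler_sum.
have tc v : y v = q w * x v -> t <= c.
  move=> yv; have qx0 : 0 < q w * x v by rewrite mulr_gt0.
  rewrite -(ler_pM2r qx0) -{1}yv (le_trans (yt v)) // (le_trans (sum_le v)) //.
  by rewrite mulrCA ler_pM2l.
have {}tc : t <= c by apply: (tc w); rewrite qx.
split=> // con [s xs]; rewrite lt_neqAle tc andbT; apply/eqP => tc'.
have step v : y v = q w * x v ->
    nbr_sum y v = q w * nbr_sum x v /\ nbr_sum x v = c * x v.
  move=> yv; have := yt v; rewrite yv tc' => h.
  have := sum_le v; have := xc v; rewrite -(ler_pM2l qw0) => h1 h2.
  have e : q w * nbr_sum x v = q w * (c * x v).
    by apply/le_anti; rewrite h1 /= (le_trans _ h2) // mulrCA.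
  split; last by apply: (mulfI _ e); rewrite gt_eqF.
  by apply/le_anti; rewrite h2 /= e mulrCA.
have all_eq v : connect (@adjacent H) w v -> y v = q w * x v.
  suff walk p u : path (@adjacent H) u p -> y u = q w * x u ->
      y (last u p) = q w * x (last u p).
    by case/connectP=> p pp ->; apply: walk => //; rewrite qx.
  elim: p u => //= a p IH u /andP[ua pp] yu; apply: IH => //.
  have [eq1 _] := step u yu; apply/eqP; rewrite eq_sym -subr_eq0; apply/eqP.
  have d0 b : adjacent u b -> 0 <= q w * x b - y b by rewrite subr_ge0.
  have /eqP : \sum_(b | adjacent u b) (q w * x b - y b) = 0.
    by rewrite big_split /= -mulr_sumr sumrN -/(nbr_sum x u) -/(nbr_sum y u) eq1 subrr.
  by rewrite psumr_eq0 // => /allP/(_ a (mem_index_enum a))/implyP/(_ ua)/eqP.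
have [_] := step s (all_eq s (con w s)).
by move/eqP; rewrite lt_eqF.
Qed.

Lemma normc_sum (I : finType) (P : pred I) (F : I -> R[i]) :
  ComplexField.Normc.normc (\sum_(i | P i) F i) <=
  \sum_(i | P i) ComplexField.Normc.normc (F i).
Proof.
elim/big_ind2: _ => //; first by rewrite ComplexField.Normc.normc0.
move=> a b c d ab cd; apply: le_trans (lerD ab cd).
by rewrite -lecR rmorphD /=; apply: (@ler_normD _ R[i]).
Qed.

Lemma normc_ge0 (z : R[i]) : 0 <= ComplexField.Normc.normc z.
Proof. by case: z => a b; apply: sqrtr_ge0. Qed.

Variables (m : nat).
Hypothesis m2 : (2 <= m)%N.

Let mR : 0 < (m - 1)%N%:R :> R.
Proof. by rewrite ltr0n subn_gt0. Qed.

Lemma normc_real (a : R) : 0 <= a -> ComplexField.Normc.normc (a%:C)%C = a.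
Proof. by move=> a0; rewrite /= expr0n addr0 sqrtr_sqr ger0_norm. Qed.

Lemma sum_enum_rank (V : nmodType) (F : 'I_#|H| -> V) :
  \sum_i F i = \sum_v F (enum_rank v).
Proof. by rewrite (reindex (@enum_rank H)) //; apply/onW_bij/enum_rank_bij. Qed.

Lemma adjacency_rank u v : adjacency R m H (enum_rank u) (enum_rank v) =
  if adjacent u v then ((m - 1)%N%:R)^-1 else 0.
Proof. by rewrite mxE !enum_rankK. Qed.

Definition spectrum_moduli : set R := [set r : R | exists2 z : R[i],
  eigenvalue (map_mx (fun x : R => real_complex R x) (adjacency R m H)) z
  & r = ComplexField.Normc.normc z]%classic.

(** Take entrywise moduli of an eigenvector and apply the triangle inequality. Eigenvectors are rows
    here, whence the appeal to the symmetry of adjacency. *)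
Lemma eigenvalue_subeigen t : spectrum_moduli t ->
  exists y, [/\ forall v, 0 <= y v, exists v, y v != 0
              & forall v, t * (m - 1)%N%:R * y v <= nbr_sum y v].
Proof.
case=> z /eigenvalueP[y yA y0] ->.
exists (fun v => ComplexField.Normc.normc (y 0 (enum_rank v))); split.
- by move=> v; apply: normc_ge0.
- have [v yv] : exists v, y 0 (enum_rank v) != 0.
    have [i yi] := rV0Pn _ y0; exists (enum_val i); by rewrite enum_valK.
  by exists v; apply: contra yv => /eqP/ComplexField.Normc.eq0_normc ->.
- move=> v; have := congr1 (fun M : 'rV_#|H| => M 0 (enum_rank v)) yA.
  rewrite !mxE sum_enum_rank => E.
  rewrite mulrAC -ComplexField.Normc.normcM -E.
  rewrite -ler_pdivlMr // mulr_suml; apply: le_trans (normc_sum _ _) _.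
  rewrite [leRHS]big_mkcond /=; apply: ler_sum => u _.
  rewrite mxE adjacency_rank adjacent_sym ComplexField.Normc.normcM.
  case: ifP => _; last by rewrite normc_real ?mulr0.
  by rewrite normc_real // invr_ge0 ltW.
Qed.

(** Finiteness keeps a bound strict in passing from the individual moduli to their supremum. *)
Lemma spectrum_finite : exists s : seq R, forall t, spectrum_moduli t -> t \in s.
Proof.
pose A := map_mx (fun x : R => real_complex R x) (adjacency R m H).
have [s sE] := closed_field_poly_normal (char_poly A).
exists (map (@ComplexField.Normc.normc R) s) => t [z zA ->]; apply: map_f.
move: zA; rewrite eigenvalue_root_char -/A sE (monicP (char_poly_monic A)).
by rewrite scale1r root_prod_XsubC.
Qed.

Lemma lambda1_lt x c : connected_hypergraph H -> (forall v, 0 < x v) ->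
  (forall v, nbr_sum x v <= c * (m - 1)%N%:R * x v) ->
  (exists v, nbr_sum x v < c * (m - 1)%N%:R * x v) -> lambda1 R m H < c.
Proof.
move=> con x0 xc [v xv].
have c0 : 0 < c.
  have: 0 < c * (m - 1)%N%:R * x v.
    by apply: le_lt_trans xv; apply: sumr_ge0 => u _; apply: ltW.
  by rewrite -mulrA pmulr_lgt0 // mulr_gt0.
have lt_c t : spectrum_moduli t -> t < c.
  move=> /eigenvalue_subeigen[y [y0 yn yt]].
  have [_ lt] := nonneg_subeigen_le x0 xc y0 yn yt.
  by rewrite -(ltr_pM2r mR); apply: lt => //; exists v.
have [s sP] := spectrum_finite.
rewrite /lambda1 /spectral_radius -/spectrum_moduli.
(* The supremum of the empty set is 0 by convention, which is below the positive [c]. *)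
have [->|/classical_sets.set0P[t0 t0P]] :=
  eqVneq spectrum_moduli (@classical_sets.set0 R).
  by rewrite sup0.
pose b := \big[Num.max/0]_(t <- s | t < c) t.
have bc : b < c by rewrite /b; elim/big_ind: _ => // u w uc wc; rewrite gt_max uc.
apply: le_lt_trans bc; apply: ge_sup; first by exists t0.
move=> t tP; have ts := sP t tP; have tc := lt_c t tP.
exact: (@le_bigmax_seq _ R _ s 0 t (fun t => t < c) id ts tc).
Qed.

Lemma lambda1_eigen x c (v0 : H) : (forall v, 0 < x v) ->
  (forall v, nbr_sum x v = c * (m - 1)%N%:R * x v) -> lambda1 R m H = c.
Proof.
move=> x0 xc.
have c0 : 0 <= c.
  have: 0 <= c * (m - 1)%N%:R * x v0 by rewrite -xc sumr_ge0 // => u _; apply: ltW.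
  by rewrite -mulrA pmulr_lge0 // mulr_gt0.
have le_c : ubound spectrum_moduli c.
  move=> t /eigenvalue_subeigen[y [y0 yn yt]].
  have xc' v : nbr_sum x v <= c * (m - 1)%N%:R * x v by rewrite xc.
  have [le _] := nonneg_subeigen_le x0 xc' y0 yn yt.
  by rewrite -(ler_pM2r mR).
have cin : spectrum_moduli c.
  exists (c%:C)%C; last by rewrite normc_real.
  apply/eigenvalueP; exists (\row_i ((x (enum_val i))%:C)%C).
    apply/rowP => j; rewrite !mxE sum_enum_rank -(enum_valK j).
    move: (enum_val j) => v.
    under eq_bigr do rewrite !mxE !enum_rankK -rmorphM /=.
    rewrite -rmorph_sum -rmorphM /=; congr (_%:C)%C; rewrite enum_rankK.
    have -> : c * x v = nbr_sum x v / (m - 1)%N%:R.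
      by rewrite xc mulrAC mulfK // gt_eqF.
    rewrite mulr_suml [RHS]big_mkcond /=; apply: eq_bigr => u _.
    by rewrite adjacent_sym; case: ifP => _; rewrite ?mulr0.
  apply/rV0Pn; exists (enum_rank v0); rewrite mxE enum_rankK.
  by apply/eqP => -[] /eqP; rewrite gt_eqF.
apply/le_anti/andP; split; first by apply: ge_sup => //; exists c.
by apply: ub_le_sup => //; exists c.
Qed.

End PerronBounds.

(** * The vector attached to a load *)

Section LoadFunction.
Variable R : realType.
Local Open Scope ring_scope.
Implicit Types q s t : R.

(* With [M = s + q = mu + 1] and load [t] (in units of [q / s]) at the far end of
   an edge, eliminating the other vertices of the edge leaves a total of
   [q / s * (1 + gain q s t)] times the value at the near end; see [gain_edge]. *)
Definition kappa q s : R := (s + 1) * q / (s + q).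
Definition gain q s t : R := t / (s ^+ 2 - kappa q s * t).
Definition critical_load q s : R := (s + q - 1) * s / q.

(** For an edge with total S, the equation at the lower vertex of load [t] is (s + q) x = S + (q /
    s) t x, so x = S / (s + q - (q / s) t); the other q - 1 lower vertices have load 0. The last
    equation says that the lower sum, [F] times the top value, is the fraction [F / (1 + F)] of
    S. *)
Lemma gain_edge q s t : 0 < q -> 0 < s -> 0 <= t -> kappa q s * t < s ^+ 2 ->
  let F := q / s * (1 + gain q s t) in
  [/\ 0 < s + q - q / s * t, 0 < 1 + F
    & (s + q - q / s * t)^-1 + (q - 1) / (s + q) = F / (1 + F)].
Proof.
move=> q0 s0 t0 ts F.
have M0 : 0 < s + q by lra.
pose E := s * (s + q) - q * t.
pose D := s ^+ 2 * (s + q) - (s + 1) * q * t.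
have qt : 0 <= q * t by apply: mulr_ge0 => //; apply: ltW.
have DE : s ^+ 2 - kappa q s * t = D / (s + q).
  by rewrite /kappa /D; field; apply/eqP; lra.
have D0 : 0 < D.
  by have : 0 < D / (s + q) by [rewrite -DE subr_gt0]; rewrite pmulr_lgt0 ?invr_gt0.
have E0 : 0 < E.
  rewrite -(pmulr_rgt0 _ s0); have -> : s * E = D + q * t by rewrite /E /D; ring.
  by lra.
have ED : D = s * E - q * t by rewrite /D /E; ring.
have sE : s + q - q / s * t = E / s by rewrite /E; field; apply/eqP; lra.
have FE : F = q * (E + t) / D.
  rewrite /F /gain DE (_ : E + t = (D + t * (s + q)) / s); last first.
    by rewrite /D /E; field; apply/eqP; lra.
  by field; rewrite !gt_eqF.
have F1 : 1 + F = (s + q) * E / D.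
  by rewrite FE ED /E; field; apply/eqP; move: D0; rewrite ED /E; lra.
rewrite sE F1; split; first by rewrite divr_gt0.
  by rewrite divr_gt0 // mulr_gt0.
rewrite FE /E; field.
by rewrite -/E !gt_eqF.
Qed.

End LoadFunction.

(** By linearity each neighbour of [v] lies in exactly one edge through [v]. *)
Lemma nbr_sum_edges (R : realType) (H : hypergraph) (x : H -> R) v :
  linear_hypergraph H ->
  nbr_sum x v = (\sum_(e in edges H | v \in e) \sum_(u in e :\ v) x u)%R.
Proof.
move=> lin; rewrite (exchange_big_dep (fun u => adjacent v u)) /=; last first.
  move=> e u /andP[eE ve]; rewrite !inE => /andP[uv ue].
  by apply/adjacentP; exists e; rewrite eq_sym.
apply: eq_bigr => u /adjacentP[e [vu eE ve ue]].
rewrite (big_pred1 e) // => f /=; rewrite !inE (eq_sym u) vu /=.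
apply/andP/eqP => [[/andP[fE vf] uf]|->]; last by rewrite eE ve.
by apply: (linear_eq lin fE eE vf ve uf ue).
Qed.

Section Harmonic.
Variables (R : realType) (H : hypergraph) (r : H) (T : rooting r).
Variables (q : nat) (s : R) (l : H -> R).
Local Open Scope ring_scope.
Hypothesis uniform : uniform_hypergraph H q.+1.
Hypothesis root_nonpendant : nonpendant r.
Hypothesis two_nonpendant :
  forall e, e \in edges H -> (#|[set v in e | nonpendant v]| <= 2)%N.
Hypothesis q0 : (0 < q)%N.
Hypothesis s0 : 0 < s.
Hypothesis lP : is_load T (gain q%:R s) l.
Hypothesis l_bound : forall w, w != r -> 0 <= l w /\ kappa q%:R s * l w < s ^+ 2.

Let Q : R := q%:R.
Let Q0 : 0 < Q. Proof. by rewrite ltr0n. Qed.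
(** The prescribed ratio of the sum over the lower vertices of [e] to the value at its top. *)
Let branch e := Q / s * (1 + \sum_(w in e :\ top T e) gain Q s (l w)).

Let card_below e : e \in edges H -> #|e :\ top T e| = q.
Proof. by move=> eE; have := cardsD1 (top T e) e; rewrite uniform // top_in //= => -[]. Qed.

Let branch_edge e : e \in edges H ->
  0 < 1 + branch e /\
  \sum_(w in e :\ top T e) (s + Q - Q / s * l w)^-1 = branch e / (1 + branch e).
Proof.
move=> eE.
have pend w : w \in e :\ top T e -> ~~ nonpendant w -> l w = 0.
  rewrite inE => /andP[wt we]; apply: (load_pendant root_nonpendant lP).
  by rewrite inE in wt; apply: below_neq_root eE we wt.
have [[c [ce cn]]|none] := below_cases T eE.
- have cr : c != r.
    by move: ce; rewrite !inE => /andP[ct ce]; apply: below_neq_root eE ce ct.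
  have other w : w \in e :\ top T e -> w != c -> l w = 0.
    move=> we wc; apply: pend => //; apply: contra wc => wn; apply/eqP.
    exact: (nonpendant_below_unique root_nonpendant two_nonpendant eE we ce).
  have bE : branch e = Q / s * (1 + gain Q s (l c)).
    rewrite /branch (bigD1 c) //= big1 ?addr0 // => w /andP[we wc].
    by rewrite other // /gain mul0r.
  have [l0 lk] := l_bound cr.
  have [_ b0 bF] := gain_edge Q0 s0 l0 lk; rewrite -bE in b0 bF; split=> //.
  rewrite (bigD1 c) //= -bF; congr (_ + _).
  have <- : \sum_(w in e :\ top T e | w != c) (s + Q)^-1 =
      \sum_(w in e :\ top T e | w != c) (s + Q - Q / s * l w)^-1.
    by apply: eq_bigr => w /andP[we wc]; rewrite other // mulr0 subr0.
  have : \sum_(w in e :\ top T e) (s + Q)^-1 = Q / (s + Q).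
    by rewrite sumr_const card_below // -mulr_natl.
  by rewrite (bigD1 c) //= mulrBl mul1r => <-; rewrite addrC addrK.
- have bE : branch e = Q / s.
    rewrite /branch big1 ?addr0 ?mulr1 // => w we.
    by rewrite pend ?none // /gain mul0r.
  have b0 : 0 < 1 + branch e by rewrite bE ltr_wpDr // divr_ge0 // ltW.
  split=> //; rewrite (eq_bigr (fun=> (s + Q)^-1)); last first.
    by move=> w we; rewrite pend ?none // mulr0 subr0.
  rewrite sumr_const card_below // -mulr_natl -/Q bE.
  by field; rewrite !gt_eqF // addr_gt0.
Qed.

(** The value at [w] over that at its parent; [1 + branch] is the total of the upper edge over its
    top value. *)
Let ratio w := (1 + branch (up T w)) / (s + Q - Q / s * l w).

Lemma harmonic_exists : exists x : H -> R, [/\ forall v, 0 < x v,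
  forall v, v != r -> nbr_sum x v = (s + Q - 1) * x v
  & nbr_sum x r = Q / s * l r * x r].
Proof.
pose X := fix X n v := if n is n'.+1 then X n' (parent T v) * ratio v else 1.
pose x v := X (depth T v) v.
have xS w : w != r -> x w = x (parent T w) * ratio w.
  by move=> wr; rewrite /x (depth_parent T wr).
have ratio0 w : w != r -> 0 < ratio w.
  move=> wr; have [l0 lk] := l_bound wr; have [M0 _ _] := gain_edge Q0 s0 l0 lk.
  by rewrite divr_gt0 //; have [] := branch_edge (up_edge T wr).
have x0 v : 0 < x v.
  have [n] := ubnP (depth T v); elim: n v => // n IH v dv.
  have [->|vr] := eqVneq v r; first by rewrite /x depth_root.
  rewrite xS // mulr_gt0 ?ratio0 //; apply: IH.
  by move: dv; rewrite (depth_parent T vr).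
have down e : e \in edges H -> \sum_(w in e :\ top T e) x w = x (top T e) * branch e.
  move=> eE; have [b0 bF] := branch_edge eE.
  have -> : branch e = (1 + branch e) * (branch e / (1 + branch e)).
    by rewrite mulrCA divff ?mulr1 // gt_eqF.
  rewrite -bF !mulr_sumr; apply: eq_bigr => w; rewrite !inE => /andP[wt we].
  rewrite xS ?(below_neq_root eE we wt) // /parent /ratio (up_below eE we wt).
  by [].
have children_sum v : \sum_(e in edges H | top T e == v) \sum_(u in e :\ v) x u =
    Q / s * l v * x v.
  rewrite lP mulr_sumr mulr_suml; apply: eq_bigr => e /andP[eE /eqP tv].
  by rewrite -tv down // mulrC.
have lin := rooting_linear T.
exists x; split=> // [v vr|]; rewrite nbr_sum_edges // (sum_edges_at_vertex T);
  rewrite children_sum; last by rewrite eqxx add0r.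
rewrite (negPf vr).
have uE := up_edge T vr; have vt := top_up_neq T vr; have vu := in_up T vr.
(* The upper edge contributes its total [x v * (s + Q - Q / s * l v)] minus [x v]; the term with the
   load cancels against the child edges. *)
have : \sum_(u in up T v) x u = x (parent T v) * (1 + branch (up T v)).
  by rewrite (big_setD1 (top T (up T v))) ?top_in //= down // mulrDr mulr1.
rewrite (big_setD1 v) //= => /(canRL (addKr _)) ->.
have [M0 _ _] := gain_edge Q0 s0 (l_bound vr).1 (l_bound vr).2.
have -> : x (parent T v) * (1 + branch (up T v)) = x v * (s + Q - Q / s * l v).
  by rewrite (xS v) // -mulrA /ratio divfK // gt_eqF.
by ring.
Qed.

End Harmonic.

Section LoadCriterion.
Variables (R : realType) (H : hypergraph) (r : H) (T : rooting r).
Variables (q : nat) (s : R) (l : H -> R).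
Local Open Scope ring_scope.
Hypothesis uniform : uniform_hypergraph H q.+1.
Hypothesis root_nonpendant : nonpendant r.
Hypothesis two_nonpendant :
  forall e, e \in edges H -> (#|[set v in e | nonpendant v]| <= 2)%N.
Hypothesis q0 : (0 < q)%N.
Hypothesis s0 : 0 < s.
Hypothesis lP : is_load T (gain q%:R s) l.
Hypothesis l_bound : forall w, w != r -> 0 <= l w /\ kappa q%:R s * l w < s ^+ 2.

Lemma lambda1_critical : l r = critical_load q%:R s ->
  lambda1 R q.+1 H = (s + q%:R - 1) / q%:R.
Proof.
move=> lr; have q0' : q%:R != 0 :> R by rewrite pnatr_eq0 -lt0n.
have [x [x0 xv xr]] :=
  harmonic_exists uniform root_nonpendant two_nonpendant q0 s0 lP l_bound.
apply: (lambda1_eigen _ r x0) => // v; rewrite subSS subn0 divfK //.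
have [->|/xv //] := eqVneq v r; rewrite xr lr /critical_load; congr (_ * _).
by field; rewrite q0' gt_eqF.
Qed.

Lemma lambda1_subcritical : l r < critical_load q%:R s ->
  lambda1 R q.+1 H < (s + q%:R - 1) / q%:R.
Proof.
move=> lr; have q0' : q%:R != 0 :> R by rewrite pnatr_eq0 -lt0n.
have [x [x0 xv xr]] :=
  harmonic_exists uniform root_nonpendant two_nonpendant q0 s0 lP l_bound.
have lt_r : nbr_sum x r < (s + q%:R - 1) * x r.
  rewrite xr ltr_pM2r // mulrC -ltr_pdivlMr; last by rewrite divr_gt0 ?ltr0n.
  apply: lt_le_trans lr _; rewrite /critical_load invf_div.
  by rewrite mulrA.
apply: (lambda1_lt _ (rooting_connected T) x0) => //.
- move=> v; rewrite subSS subn0 divfK //.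
  by have [->|/xv -> //] := eqVneq v r; apply: ltW.
- by exists r; rewrite subSS subn0 divfK.
Qed.

End LoadCriterion.

(** * Inequalities for the gain *)

Section GainInequalities.
Variables (R : realType) (q s : R).
Local Open Scope ring_scope.
Hypotheses (q0 : 0 < q) (s0 : 0 < s).
Local Notation g := (gain q s).
Local Notation K := (kappa q s).

Lemma kappa_gt0 : 0 < K.
Proof.
move: (q0) (s0) => q0' s0'; by rewrite /kappa divr_gt0 ?mulr_gt0 //; lra. Qed.

Lemma kappa_lt : K < s + 1.
Proof. move: (q0) (s0) => q0' s0'. by rewrite /kappa ltr_pdivrMr ?ltr_pM2l; lra. Qed.

(** The denominator of the gain equals 1 exactly at the load [critical_load - 1]; up to that load
    the gain stays below its pole and is at most the identity. *)
Lemma kappa_critical : s ^+ 2 = 1 + K * (critical_load q s - 1).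
Proof. by rewrite /kappa /critical_load; field; rewrite !gt_eqF // addr_gt0. Qed.

Lemma gain_ge0 t : 0 <= t -> K * t < s ^+ 2 -> 0 <= g t.
Proof. by move=> t0 tK; rewrite /gain divr_ge0 // subr_ge0 ltW. Qed.

Lemma gain0 : g 0 = 0. Proof. by rewrite /gain mul0r. Qed.

Lemma gain_le t u : 0 <= t -> t <= u -> K * u < s ^+ 2 -> g t <= g u.
Proof.
move: (q0) (s0) => q0' s0'.
move=> t0 tu uK; have K0 := kappa_gt0.
have tK : K * t <= K * u by rewrite ler_pM2l.
rewrite /gain ler_pM ?invr_ge0 ?subr_ge0 //; first by lra.
by rewrite lef_pV2 ?posrE; lra.
Qed.

Lemma gain_lt t u : 0 <= t -> t < u -> K * u < s ^+ 2 -> g t < g u.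
Proof.
move: (q0) (s0) => q0' s0'.
move=> t0 tu uK; have K0 := kappa_gt0.
have tK : K * t < K * u by rewrite ltr_pM2l.
apply: (@lt_le_trans _ _ (u / (s ^+ 2 - K * t))).
  by rewrite ltr_pM2r // invr_gt0; lra.
by rewrite ler_wpM2l //; [lra|rewrite lef_pV2 ?posrE; lra].
Qed.

(** The factor [1 / (s ^ 2 - K t)] increases strictly with [t]. Superadditivity is the form in which
    convexity is used. *)
Lemma gainD t u : 0 < t -> 0 < u -> K * (t + u) < s ^+ 2 -> g t + g u < g (t + u).
Proof.
move: (q0) (s0) => q0' s0'.
move=> t0 u0 tuK; have K0 := kappa_gt0.
have Kt : 0 < K * t by apply: mulr_gt0.
have Ku : 0 < K * u by apply: mulr_gt0.
rewrite mulrDr in tuK; rewrite /gain mulrDl mulrDr.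
by apply: ltrD; rewrite ltr_pM2l // ltf_pV2 ?posrE; lra.
Qed.

Lemma gain_le_self t : 0 <= t -> t <= critical_load q s - 1 -> g t <= t.
Proof.
move: (q0) (s0) => q0' s0'.
move=> t0 tc; have K0 := kappa_gt0; rewrite /gain kappa_critical.
have : K * t <= K * (critical_load q s - 1) by rewrite ler_pM2l.
by move=> h; rewrite ler_pdivrMr; [rewrite ler_peMr //; lra|lra].
Qed.

Lemma gain_sum_le (I : finType) (P : pred I) (F : I -> R) B :
  K * B < s ^+ 2 -> (forall i, P i -> 0 <= F i) -> \sum_(i | P i) F i <= B ->
  \sum_(i | P i) g (F i) <= g (\sum_(i | P i) F i).
Proof.
move: (q0) (s0) => q0' s0'.
move=> BK F0 FB; have K0 := kappa_gt0.
rewrite [leRHS]/gain mulr_suml; apply: ler_sum => i Pi.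
have Fi : F i <= \sum_(i | P i) F i.
  by rewrite (bigD1 i) //= lerDl sumr_ge0 // => j /andP[/F0].
rewrite /gain ler_wpM2l ?F0 // lef_pV2 ?posrE ?subr_gt0.
- by rewrite lerD2l lerN2 ler_pM2l.
- by apply: le_lt_trans BK; rewrite ler_pM2l // (le_trans Fi).
- by apply: le_lt_trans BK; rewrite ler_pM2l.
Qed.

Hypothesis s7 : 7 <= s.

(** As [K < s + 1], the denominator is at least [s ^ 2 - 4 (s + 1)], which is 17 at [s = 7] and
    increases from there. *)
Lemma gain_den4 t : t <= 4 -> 17 <= s ^+ 2 - K * t.
Proof.
move: (q0) (s0) (s7) => q0' s0' s7'.
move=> t4; have K0 := kappa_gt0; have Ks := kappa_lt.
have : K * t <= K * 4 by rewrite ler_pM2l.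
have : 0 <= (s - 7) * (s + 3) by apply: mulr_ge0; lra.
by rewrite expr2; lra.
Qed.

Lemma kappa4 t : t <= 4 -> K * t < s ^+ 2.
Proof. by move=> /gain_den4; lra. Qed.

Lemma gain_third t : 0 <= t -> t <= 4 -> g t <= 3^-1.
Proof.
move: (q0) (s0) (s7) => q0' s0' s7'.
move=> t0 t4; have := gain_den4 t4.
by rewrite /gain => h; rewrite ler_pdivrMr; lra.
Qed.

Let a := (s ^+ 2 - K)^-1.
Let g1a : g 1 = a. Proof. by rewrite /gain mulr1 mul1r. Qed.
(** 8 / 49 is the value of [(s + 1) / s ^ 2] at [s = 7]. *)
Let theta : K <= 8 / 49 * s ^+ 2.
Proof.
move: (q0) (s0) (s7) => q0' s0' s7'.
apply: le_trans (ltW kappa_lt) _.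
have : 0 <= (s - 7) * (8 * s + 7) by apply: mulr_ge0; lra.
by rewrite expr2; lra.
Qed.
Let s49 : 49 <= s ^+ 2.
Proof.
move: (s7) => s7'; have : 0 <= (s - 7) * (s + 7) by apply: mulr_ge0; lra.
by rewrite expr2; lra.
Qed.

(** Multiplied out with [a = g 1] and [a (s ^ 2 - K) = 1], the claim is [1 + a < 2 - 2 K a ^ 2].
    Here [a <= 1 / 41], where 41 = 49 - 8, and [K a ^ 2 <= 8 / 41 ^ 2]. *)
Lemma gain_chain2 : g (1 + g 1) < 2 * g 1.
Proof.
move: (q0) (s0) (s7) (theta) (s49) => q0' s0' s7' theta' s49'.
have K0 := kappa_gt0; rewrite g1a.
have D0 : 0 < s ^+ 2 - K by lra.
have a0 : 0 < a by rewrite invr_gt0.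
have aD : a * (s ^+ 2 - K) = 1 by rewrite mulVf // gt_eqF.
have a41 : a <= 41^-1 by rewrite lef_pV2 ?posrE; lra.
have Ka : K * a <= K / 41 by rewrite ler_pM2l.
have Kaa : a * (K * a) <= a * (s ^+ 2 - K) * (8 / 41 / 41).
  by rewrite -mulrA ler_pM2l //; lra.
rewrite /gain ltr_pdivrMr; last by lra.
have -> : 2 * a * (s ^+ 2 - K * (1 + a)) = 2 * (a * (s ^+ 2 - K)) - 2 * (a * (K * a)).
  by ring.
by rewrite aD in Kaa *; lra.
Qed.

Lemma gain_chain3 : g (2 + g 1) < g 1 + g 2.
Proof.
move: (q0) (s0) (s7) (theta) (s49) => q0' s0' s7' theta' s49'.
have K0 := kappa_gt0; rewrite g1a.
have D0 : 0 < s ^+ 2 - K by lra.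
have a0 : 0 < a by rewrite invr_gt0.
have a1 : a <= 1 by rewrite -g1a; apply: le_trans (gain_third _ _) _; lra.
have Ka : K * a <= K by rewrite ger_pMr.
have X0 : 0 < s ^+ 2 - K * (2 + a) by lra.
have Y0 : 0 < s ^+ 2 - K * 2 by lra.
(* With Y and X the denominators at 2 and [2 + a], the two sides of the claim differ by
   [a (Y X - s ^ 2) / (Y X)]. The 25 comes from [X >= s ^ 2 - 3 K >= (1 - 24 / 49) s ^ 2]. *)
have XY : s ^+ 2 < (s ^+ 2 - K * 2) * (s ^+ 2 - K * (2 + a)).
  apply: (@lt_le_trans _ _ ((s ^+ 2 - K * 2) * 25)); first by lra.
  by rewrite ler_pM2l //; lra.
rewrite /gain -subr_gt0.
have -> : a + 2 / (s ^+ 2 - K * 2) - (2 + a) / (s ^+ 2 - K * (2 + a)) =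
  a * ((s ^+ 2 - K * 2) * (s ^+ 2 - K * (2 + a)) - s ^+ 2) /
  ((s ^+ 2 - K * 2) * (s ^+ 2 - K * (2 + a))).
  by field; rewrite !gt_eqF.
by rewrite divr_gt0 ?mulr_gt0 //; lra.
Qed.

(* Seen from one hub, a double broom with hub degrees [D] and [N + 1] has load
   [D + g N]; clearing denominators makes the comparison symmetric in the two
   hubs, so it is worst when one of them is as small as allowed. *)
Lemma double_broom_load D N : 5 <= D -> 4 <= N ->
  critical_load q s = D + N - 3 + g 1 + g 2 ->
  D + g N < critical_load q s.
Proof.
move: (q0) (s0) (s7) => q0' s0' s7'.
move=> D5 N4 cE; have K0 := kappa_gt0.
pose c := critical_load q s; rewrite -/c in cE *.
have e0 : 0 <= g 1 + g 2.
  by apply: addr_ge0; apply: gain_ge0; rewrite ?kappa4 //; lra.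
pose X := c - D; pose Y := c - 1 - N.
have [X1 Y1] : 1 <= X /\ 1 <= Y by rewrite /X /Y cE; split; lra.
(* [K (c - 1) = s ^ 2 - 1], so [K (c - 5)] is the denominator at load 4 minus 1, hence at least 17 -
   1. *)
have K16 : 16 <= K * (c - 5).
  by have := gain_den4 (lexx 4); rewrite kappa_critical -/c; lra.
have XY : c - 5 <= X * Y.
  have : 0 <= (X - 1) * (Y - 1) by apply: mulr_ge0; lra.
  have -> : c - 5 = X + Y - 1 - (g 1 + g 2) by rewrite /X /Y cE; lra.
  by lra.
have KXY : 16 <= K * (X * Y) by apply: le_trans K16 _; rewrite ler_pM2l.
have KY : 0 < K * Y by apply: mulr_gt0 => //; lra.
have den : s ^+ 2 - K * N = 1 + K * Y by rewrite kappa_critical /Y -/c; ring.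
(* The claim turns into [N < X + K X Y]; as [X >= N - 3], the lower bound 16 on [K X Y] is ample. *)
rewrite -ltrBrDl -/X /gain den ltr_pdivrMr; last by lra.
have -> : X * (1 + K * Y) = X + K * (X * Y) by ring.
by rewrite /X cE in KXY *; lra.
Qed.

End GainInequalities.

(** * Solving for the parameter at which a load is critical *)

Section CriticalParameter.
Variables (R : realType) (q : R).
Local Open Scope ring_scope.
Import numFieldNormedType.Exports.
Hypothesis q1 : 1 <= q.

(** Values in [0, 4] keep the denominator of the gain at 17 or more, so that composing with the gain
    preserves continuity. *)
Definition tame (t : R -> R) := forall s : R, 7 <= s ->
  [/\ (t x @[x --> s] --> t s)%classic, 0 <= t s & t s <= 4].

Lemma tame_cst c : 0 <= c -> c <= 4 -> tame (fun=> c).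
Proof. by move=> c0 c4 s _; split=> //; apply: cvg_cst. Qed.

Lemma cvg_gain (t : R -> R) (s : R) : tame t -> 7 <= s ->
  (gain q x (t x) @[x --> s] --> gain q s (t s))%classic.
Proof.
move: (q1) => q1'.
move=> tt s7; have [tc t0 t4] := tt s s7.
have [q0 s0] : 0 < q /\ 0 < s by split; lra.
have := gain_den4 q0 s0 s7 t4 => den.
have cid : ((x : R) @[x --> s] --> s)%classic by apply: cvg_id.
apply: cvgM => //; apply: cvgV; first by rewrite gt_eqF; lra.
apply: cvgB; first exact: (cvgM cid cid).
apply: cvgM => //; apply: cvgM.
  by apply: cvgM; [apply: cvgD => //; apply: cvg_cst|apply: cvg_cst].
apply: cvgV; first by rewrite gt_eqF; lra.
by apply: cvgD => //; apply: cvg_cst.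
Qed.

Lemma tame_gain1 c : 0 <= c -> c <= 3 -> tame (fun s => c + gain q s 1).
Proof.
move: (q1) => q1'.
move=> c0 c3 s s7; have [q0 s0] : 0 < q /\ 0 < s by split; lra.
have t1 := tame_cst ler01 (ltac:(lra) : (1 : R) <= 4).
split; first by apply: cvgD; [apply: cvg_cst|apply: cvg_gain].
- by apply: addr_ge0 => //; apply: gain_ge0; rewrite ?kappa4 //; lra.
- by have := gain_third q0 s0 s7 ler01 (ltac:(lra) : (1 : R) <= 4); lra.
Qed.

(** Intermediate value theorem on [7, k q + 7]: the critical load is [7 + 42 / q <= k - 3] at the
    left end and at least [(k q + 7) / q >= k] at the right end. *)
Lemma critical_solution (k : R) (F : R -> R) :
  42 <= (k - 10) * q -> (forall s : R, 7 <= s -> (F x @[x --> s] --> F s)%classic) ->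
  (forall s : R, 7 <= s -> k - 3 <= F s <= k) ->
  exists2 s, 7 <= s & F s = critical_load q s.
Proof.
move: (q1) => q1'.
move=> k42 Fc Fb; pose b := k * q + 7.
have k10 : 0 <= k - 10.
  rewrite leNgt; apply/negP => k10; suff : (k - 10) * q <= 0 by lra.
  by rewrite nmulr_rle0 //; lra.
have kq : 0 <= k * q by apply: mulr_ge0; lra.
have b7 : 7 <= b by rewrite /b; lra.
pose G s := critical_load q s - F s.
have [||c cb Gc] := @IVT R G 7 b 0 b7.
- apply: continuous_in_subspaceT => s /set_mem; rewrite /= in_itv /= => /andP[s7 _].
  apply: cvgB; last exact: Fc.
  have cid : ((x : R) @[x --> s] --> s)%classic by apply: cvg_id.
  apply: cvgM; last exact: cvg_cst.
  apply: cvgM => //; apply: cvgB; last exact: cvg_cst.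
  by apply: cvgD => //; apply: cvg_cst.
- have G7 : G 7 <= 0.
    have /andP[F7 _] := Fb 7 (lexx 7); rewrite /G subr_le0; apply: le_trans F7.
    by rewrite /critical_load ler_pdivrMr; lra.
  have Gb : 0 <= G b.
    have /andP[_ Fbk] := Fb b b7; rewrite /G subr_ge0; apply: le_trans Fbk _.
    rewrite /critical_load ler_pdivlMr; last by lra.
    have : b <= (b + q - 1) * b by rewrite ler_peMl //; lra.
    by rewrite /b; lra.
  by rewrite ge_min G7 le_max Gb orbT.
- exists c; last by move/eqP: Gc; rewrite /G subr_eq0 eq_sym => /eqP.
  by move: cb; rewrite in_itv => /andP[].
Qed.

End CriticalParameter.

(** * Isomorphism from degrees and adjacencies *)

(** The i-th element of a fibre of [f] goes to the i-th element of the fibre of [g] over the same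
    point. *)
Lemma fiber_bijection (A B C : finType) (f : A -> C) (g : B -> C) :
  (forall c, #|[set a | f a == c]| = #|[set b | g b == c]|) ->
  exists2 h : A -> B, bijective h & forall a, g (h a) = f a.
Proof.
move=> fg.
have card_fibers (D : finType) (k : D -> C) : #|D| = \sum_c #|[set d | k d == c]|.
  rewrite -sum1_card (partition_big k xpredT) //=; apply: eq_bigr => c _.
  by rewrite -sum1_card; apply: eq_bigl => d; rewrite inE.
have cardAB : #|A| = #|B|.
  by rewrite (card_fibers A f) (card_fibers B g); apply: eq_bigr.
have [b0 _|noB] := pickP {: B}; last first.
  have noA : A -> False.
    by move=> a; have := max_card (pred1 a); rewrite cardAB card1 eq_card0.
  exists (fun a => match noA a with end); last by move=> a; case: (noA a).
  apply: inj_card_bij; last by rewrite cardAB.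
  by move=> a; case: (noA a).
pose h a := nth b0 (enum [set b | g b == f a]) (index a (enum [set a' | f a' == f a])).
have idx a : index a (enum [set a' | f a' == f a]) < size (enum [set b | g b == f a]).
  by rewrite -cardE -fg cardE index_mem mem_enum inE.
have hP a : g (h a) = f a.
  have := mem_nth b0 (idx a); rewrite mem_enum inE => /eqP; exact.
exists h => //; apply: inj_card_bij; last by rewrite cardAB.
move=> a a' E; have fE : f a = f a' by rewrite -hP E hP.
move: E; rewrite /h fE => /eqP; rewrite nth_uniq ?enum_uniq //.
- move/eqP => ii; have am : a \in enum [set c | f c == f a'] by rewrite mem_enum inE fE.
  by rewrite -(nth_index a am) ii nth_index // mem_enum inE.
- by have := idx a; rewrite fE.
Qed.

(** Together with uniformity and the number of edges, these data fix a hypertree having at least one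
    edge up to isomorphism. [adj] relates indices in [nat], so that one relation serves every
    length. *)
Definition has_profile (H : hypergraph) (ds : seq nat) (adj : rel nat) : Prop :=
  exists v : 'I_(size ds) -> H, [/\ injective v,
    forall x, nonpendant x = (x \in codom v),
    forall i, degree (v i) = nth 0 ds i
    & forall i j, adjacent (v i) (v j) = adj i j].

Section Colours.
Variables (H : hypergraph) (n : nat) (v : 'I_n -> H).
Hypothesis lin : linear_hypergraph H.
Hypothesis two_nonpendant :
  forall e, e \in edges H -> #|[set x in e | nonpendant x]| <= 2.
Hypothesis vinj : injective v.
Hypothesis vP : forall x, nonpendant x = (x \in codom v).

(* A uniform linear hypergraph is determined by its edges, each coloured by the
   set of nonpendant vertices on it; these colour classes are in turn determined
   by the degrees and adjacencies of the nonpendant vertices. *)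
Definition colour (e : {set H}) : {set 'I_n} := [set i | v i \in e].

Definition colour_count (A : {set 'I_n}) : nat :=
  #|[set e in edges H | colour e == A]|.

Lemma card_colour e : #|colour e| = #|[set x in e | nonpendant x]|.
Proof.
rewrite -(card_imset _ vinj); apply: eq_card => x; rewrite !inE.
apply/imsetP/andP => [[j]|[xe]]; first by rewrite inE vP => je ->; rewrite codom_f.
by rewrite vP => /codomP[i xi]; exists i; rewrite // inE -xi.
Qed.

Lemma colour_count_gt2 (A : {set 'I_n}) : 2 < #|A| -> colour_count A = 0.
Proof.
move=> A2; apply: eq_card0 => e; rewrite !inE; apply/negP => /andP[eE /eqP eA].
by move: A2; rewrite -eA card_colour ltnNge two_nonpendant.
Qed.

(** By linearity only one edge passes through two adjacent vertices, and it has no third nonpendant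
    vertex. *)
Lemma colour_count_pair i j : i != j ->
  colour_count [set i; j] = adjacent (v i) (v j).
Proof.
move=> ij; rewrite /colour_count.
have vij : v i != v j by rewrite (inj_eq vinj).
have [/adjacentP[e [_ eE ie je]]|nadj] := boolP (adjacent (v i) (v j)).
  rewrite (_ : [set _ in _ | _] = [set e]) ?cards1 //; apply/setP => f.
  rewrite !inE; apply/andP/eqP => [[fE /eqP fc]|->].
    have [fi fj] : v i \in f /\ v j \in f.
      by have := set21 i j; have := set22 i j; rewrite -fc !inE.
    exact: (linear_eq lin fE eE fi ie fj je vij).
  split=> //; rewrite eq_sym eqEcard; apply/andP; split.
    by apply/subsetP => k; rewrite !inE => /orP[] /eqP->.
  by rewrite cards2 ij card_colour two_nonpendant.
apply: eq_card0 => e; rewrite !inE; apply/negP => /andP[eE /eqP ec].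
case/negP: nadj; apply/adjacentP; exists e.
by have := set21 i j; have := set22 i j; rewrite -ec !inE.
Qed.

Lemma colour_count_degree i : \sum_(A : {set 'I_n} | i \in A) colour_count A = degree (v i).
Proof.
rewrite /degree -sum1_card (partition_big colour (fun A => i \in A)) /=; last first.
  by move=> e; rewrite !inE => /andP[].
apply: eq_bigr => A iA; rewrite /colour_count -sum1_card; apply: eq_bigl => e.
rewrite !inE -andbA; congr (_ && _); apply/idP/andP => [eA|[]//].
by split=> //; move: iA; rewrite -(eqP eA) inE.
Qed.

Lemma colour_count_all : \sum_A colour_count A = #|edges H|.
Proof.
rewrite -sum1_card (partition_big colour xpredT) //=; apply: eq_bigr => A _.
by rewrite /colour_count -sum1_card; apply: eq_bigl => e; rewrite inE.
Qed.

Lemma card_edge_pendant m e : uniform_hypergraph H m -> e \in edges H ->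
  #|[set x in e | ~~ nonpendant x]| = m - #|colour e|.
Proof.
move=> unif eE; rewrite card_colour -(unif e eE) -(cardsID [set x | nonpendant x] e).
rewrite [X in X + _ - _](_ : _ = #|[set x in e | nonpendant x]|).
  by rewrite addKn; apply: eq_card => x; rewrite !inE andbC.
by apply: eq_card => x; rewrite !inE.
Qed.

End Colours.

(** Colour counts agree by decreasing size of the colour: size two by adjacency, size one by the
    degree, the empty colour by the total. A colour-preserving bijection of edges then extends to
    vertices by matching stars, the sets of edges through a vertex. *)
Lemma profile_isomorphic (G H : hypergraph) m (ds : seq nat) (adj : rel nat) :
  uniform_hypergraph G m -> uniform_hypergraph H m ->
  hypertree G -> hypertree H -> #|edges G| = #|edges H| ->
  (forall x : G, 0 < degree x) -> (forall x : H, 0 < degree x) ->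
  has_profile G ds adj -> has_profile H ds adj -> isomorphic G H.
Proof.
move=> unifG unifH [_ linG _ twoG] [_ linH _ twoH] cardE degG degH.
case=> v [vinj vP vdeg vadj] [w [winj wP wdeg wadj]].
have count2 (A : {set 'I_(size ds)}) : 1 < #|A| -> colour_count v A = colour_count w A.
  rewrite leq_eqVlt => /orP[|A2]; last by rewrite !colour_count_gt2.
  rewrite eq_sym => /cards2P[i [j [ij ->]]].
  by rewrite !colour_count_pair // vadj wadj.
have count1 i : colour_count v [set i] = colour_count w [set i].
  have := colour_count_degree v i; rewrite vdeg -wdeg -colour_count_degree.
  rewrite (bigD1 [set i]) ?inE //= [in RHS](bigD1 [set i]) ?inE //=.
  rewrite (eq_bigr (colour_count w)); first by move/addIn.
  move=> A /andP[iA nA]; apply: count2; rewrite ltn_neqAle card_gt0.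
  apply/andP; split; last by apply/set0Pn; exists i.
  apply: contra nA; rewrite eq_sym => /cards1P[j jA].
  by move: iA; rewrite jA inE => /eqP->.
have count A : colour_count v A = colour_count w A.
  have [A1|] := ltnP 1 #|A|; first exact: count2.
  rewrite leq_eqVlt ltnS leqn0 cards_eq0 => /orP[/cards1P[i ->] //|/eqP->].
  have := colour_count_all v; rewrite cardE -(colour_count_all w).
  rewrite (bigD1 set0) //= [in RHS](bigD1 set0) //=.
  rewrite (eq_bigr (colour_count w)); first by move/addIn.
  move=> B B0; have [B1|] := ltnP 1 #|B|; first exact: count2.
  by rewrite leq_eqVlt ltnS leqn0 cards_eq0 (negPf B0) orbF => /cards1P[i ->].
pose EG := {e : {set G} | e \in edges G}; pose EH := {e : {set H} | e \in edges H}.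
have sub_count (K : hypergraph) (u : 'I_(size ds) -> K) A :
    #|[set e : {e : {set K} | e \in edges K} | colour u (val e) == A]| = colour_count u A.
  rewrite /colour_count -(card_imset _ val_inj); apply: eq_card => e.
  apply/imsetP/idP => [[[f fE]]|]; first by rewrite !inE /= => fA ->; rewrite fE.
  by rewrite !inE => /andP[eE eA]; exists (Sub e eE); rewrite ?inE.
have [|h hbij hcol] := @fiber_bijection EG EH _ (fun e => colour v (val e))
    (fun e => colour w (val e)).
  by move=> A; rewrite !sub_count.
have hinj := bij_inj hbij.
pose starG x := [set e : EG | x \in val e]; pose starH y := [set e : EH | y \in val e].
have star_nonpendant i : h @: starG (v i) = starH (w i).
  have hi (e : EG) : (v i \in val e) = (w i \in val (h e)).
    have /setP/(_ i) := hcol e; by rewrite !inE.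
  apply/setP => f; rewrite inE; apply/imsetP/idP => [[e]|fi].
    by rewrite inE hi => ei ->.
  have [h' hK h'K] := hbij; exists (h' f); last by rewrite h'K.
  by rewrite inE hi h'K.
have star_card (K : hypergraph) (x : K) :
    #|[set e : {e : {set K} | e \in edges K} | x \in val e]| = degree x.
  rewrite /degree -(card_imset _ val_inj); apply: eq_card => e.
  apply/imsetP/idP => [[[f fE]]|]; first by rewrite !inE /= => fA ->; rewrite fE.
  by rewrite !inE => /andP[eE eA]; exists (Sub e eE); rewrite ?inE.
have split_count (K : hypergraph) (u : 'I_(size ds) -> K) (P : pred K) :
    injective u -> (forall x, nonpendant x = (x \in codom u)) ->
    #|[set x | P x]| = \sum_i P (u i) + #|[set x | ~~ nonpendant x & P x]|.
  move=> uinj uP; rewrite -(cardsID [set x | nonpendant x]); congr (_ + _); last first.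
    by apply: eq_card => x; rewrite !inE andbC.
  rewrite -sum1_card; transitivity (\sum_(i | P (u i)) 1); last first.
    by rewrite big_mkcond; apply: eq_bigr => i _; case: (P (u i)).
  transitivity (\sum_(x in [set u i | i in [pred i | P (u i)]]) 1); last first.
    by rewrite big_imset //= => i j _ _; apply: uinj.
  apply: eq_bigl => x; rewrite !inE uP; apply/andP/imsetP => [[Px /codomP[i xi]]|[i Pi ->]].
    by exists i; rewrite // inE -xi.
  by rewrite codom_f; split.
have star_pendant (K : hypergraph) (x : K) : 0 < degree x -> ~~ nonpendant x ->
    exists e0, [set e : {e : {set K} | e \in edges K} | x \in val e] = [set e0].
  rewrite /nonpendant -leqNgt -star_card => x0 x1.
  by apply/cards1P; rewrite eqn_leq x0 x1.
have pend_count (K : hypergraph) (u : 'I_(size ds) -> K)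
    (f : {e : {set K} | e \in edges K}) :
    uniform_hypergraph K m -> (forall x : K, 0 < degree x) ->
    injective u -> (forall x, nonpendant x = (x \in codom u)) ->
    #|[set x | ~~ nonpendant x & [set e : {e : {set K} | e \in edges K} | x \in val e]
        == [set f]]| = m - #|colour u (val f)|.
  move=> unif deg uinj uP; rewrite -(card_edge_pendant uinj uP unif (valP f)).
  apply: eq_card => x; rewrite !inE andbC; apply: andb_id2r => xp.
  have [e0 xe] := star_pendant K x (deg x) xp; rewrite xe.
  have -> : (x \in val f) = (f \in [set e0]) by rewrite -xe inE.
  by rewrite inE; apply/eqP/eqP => [/set1_inj|] ->.
(* Pendant vertices have one-edge stars, and [m] minus the size of the colour of [f] of them have
   star [{f}]; a set of edges that is not a singleton is the star of no pendant vertex. *)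
have [|k kbij kstar] := @fiber_bijection G H _ (fun x => h @: starG x) starH.
  move=> F; rewrite (split_count G v) // (split_count H w) //; congr (_ + _).
    by apply: eq_bigr => i _; rewrite star_nonpendant.
  have [/cards1P[f ->]|F1] := boolP (#|F| == 1).
    have [h' hK h'K] := hbij.
    rewrite (pend_count H w) // -(h'K f) hcol -(pend_count G v) //.
    apply: eq_card => x; rewrite !inE; congr (_ && _).
    by rewrite -imset_set1 (inj_eq (imset_inj hinj)).
  rewrite !eq_card0 // => x; rewrite !inE; apply/negP => /andP[xp /eqP xF].
    have [e0 xe] := star_pendant H x (degH x) xp.
    by move: F1; rewrite -xF /starH xe cards1.
  have [e0 xe] := star_pendant G x (degG x) xp.
  by move: F1; rewrite -xF /starG xe imset_set1 cards1.
exists k => //.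
have kin (e : EG) x : (k x \in val (h e)) = (x \in val e).
  have := in_set (fun f : EH => k x \in val f) (h e) => <-.
  by rewrite -/(starH (k x)) kstar mem_imset // inE.
have kedge (e : EG) : k @: val e = val (h e).
  apply/setP => y; have [k' kK k'K] := kbij.
  by rewrite -(k'K y) mem_imset ?kin //; apply: bij_inj.
apply/setP => f; apply/imsetP/idP => [[e eE ->]|fE].
  by rewrite -[e]/(val (Sub e eE : EG)) kedge; apply: valP.
have [h' hK h'K] := hbij.
exists (val (h' (Sub f fE))); first exact: valP.
by rewrite kedge h'K.
Qed.

(** * The hypertrees T_d *)

Section Caterpillar.
Variables (m d : nat) (c : path_vertex m d -> nat).
Hypothesis m2 : 1 < m.
Local Notation q := (m - 1).

Definition caterpillar : hypergraph := @attach_pendant m (loose_path m d) c.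

Local Notation C := caterpillar.

Definition trunk (i : nat) : {set C} :=
  [set (inl x : C) | x in path_edge m d i.+1].

Local Notation leaf p := (@pendant_edge m (loose_path m d) c p : {set C}).

Lemma q_gt0 : 0 < q. Proof. by rewrite subn_gt0. Qed.

Lemma inl_trunk i (x : path_vertex m d) :
  ((inl x : C) \in trunk i) = (i * q <= x <= i.+1 * q).
Proof.
rewrite mem_imset; last by move=> u v [].
by rewrite inE /path_pos !subn1.
Qed.

Lemma inr_trunk i u : ((inr u : C) \in trunk i) = false.
Proof. by apply/imsetP => -[]. Qed.

Lemma inl_leaf p (x : path_vertex m d) : ((inl x : C) \in leaf p) = (x == tag p).
Proof.
rewrite !inE; apply/orP/eqP => [[/eqP[] //|/imsetP[] //]|->].
by left; rewrite eqxx.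
Qed.

Lemma inr_leaf p p' (t : 'I_q) : ((inr (p', t) : C) \in leaf p) = (p' == p).
Proof.
rewrite !inE /=; apply/imsetP/eqP => [[t' _ [->]] //|->]; by exists t.
Qed.

Lemma mem_caterpillar_edges e :
  e \in edges C <-> (exists i : 'I_d, e = trunk i) \/ (exists p, e = leaf p).
Proof.
split.
  case/setUP=> /imsetP[]; last by move=> p _ ->; right; exists p.
  by move=> f /imsetP[i _ ->] ->; left; exists i.
case=> [[i ->]|[p ->]]; apply/setUP; [left|right]; last exact: imset_f.
by apply: imset_f; apply: imset_f.
Qed.

Lemma trunk_edge (i : 'I_d) : trunk i \in edges C.
Proof. by apply/mem_caterpillar_edges; left; exists i. Qed.

Lemma leaf_edge p : leaf p \in edges C.
Proof. by apply/mem_caterpillar_edges; right; exists p. Qed.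

(** Counting starts at 0: [joint j] is v_(j+1), and [trunk i] is e_(i+1) with ends at the joints [i]
    and [i.+1]. Meaningful for [j <= d]. *)
Definition joint (j : nat) : path_vertex m d := inord (j * q).

Lemma val_joint j : j <= d -> joint j = j * q :> nat.
Proof. by move=> jd; rewrite inordK // ltnS leq_mul2r jd orbT. Qed.

Lemma trunk_inj : injective (fun i : 'I_d => trunk i).
Proof.
have le i j : i < d -> trunk i = trunk j -> j <= i <= j.+1.
  move=> id E; have : j * q <= joint i <= j.+1 * q.
    by rewrite -inl_trunk -E inl_trunk (val_joint (ltnW id)) leqnn leq_mul2r leqnSn orbT.
  by rewrite (val_joint (ltnW id)) !leq_mul2r eqn0Ngt q_gt0.
move=> i j E; apply/val_inj/eqP; rewrite eqn_leq /=.
by have /andP[-> _] := le i j (ltn_ord i) E; have /andP[-> _] := le j i (ltn_ord j) (esym E).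
Qed.

Lemma leaf_inj : injective (fun p => leaf p).
Proof.
move=> p p' E; have := inr_leaf p p (Ordinal q_gt0).
by rewrite E inr_leaf eqxx => /eqP.
Qed.

Lemma trunk_neq_leaf i p : trunk i != leaf p.
Proof.
apply/eqP => E; have := inr_leaf p p (Ordinal q_gt0).
by rewrite -E inr_trunk eqxx.
Qed.

Lemma caterpillar_edge_count (P : pred {set C}) :
  #|[set e in edges C | P e]| = #|[set i : 'I_d | P (trunk i)]| + #|[set p | P (leaf p)]|.
Proof.
rewrite -(card_imset _ trunk_inj) -(card_imset _ leaf_inj) -cardsUI.
rewrite [X in _ = _ + X]eq_card0 ?addn0; last first.
  move=> e; rewrite inE; apply/negP => /andP[/imsetP[i _ ->] /imsetP[p _ /eqP]].
  by rewrite (negPf (trunk_neq_leaf _ _)).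
apply: eq_card => e; apply/setIdP/setUP.
  case=> /mem_caterpillar_edges[[i ->]|[p ->]] Pe; [left|right]; apply/imsetP.
    by exists i; rewrite ?inE.
  by exists p; rewrite ?inE.
case=> /imsetP[z]; rewrite inE => Pz ->.
  by rewrite trunk_edge.
by rewrite leaf_edge.
Qed.

Lemma caterpillar_edges_card : #|edges C| = d + \sum_x c x.
Proof.
have := caterpillar_edge_count xpredT.
rewrite (_ : [set e in edges C | true] = edges C); last by apply/setP => e; rewrite inE andbT.
move=> ->; rewrite !(@eq_card _ _ predT) ?card_ord.
- rewrite card_tagged sumnE big_map enumT; congr (_ + _).
  by apply: eq_bigr => x _; rewrite card_ord.
- by move=> p; rewrite inE.
- by move=> i; rewrite inE.
Qed.

Lemma caterpillar_uniform : uniform_hypergraph C m.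
Proof.
move=> e /mem_caterpillar_edges[[i ->]|[p ->]].
  rewrite card_imset; last by move=> u v [].
  have iq : i.+1 * q <= d * q by rewrite leq_mul2r ltn_ord orbT.
  have inj : injective (fun t : 'I_m => inord (i * q + t) : path_vertex m d).
    move=> t t' /(congr1 val) /=; rewrite !inordK; last 2 first.
    - by have := ltn_ord t'; lia.
    - by have := ltn_ord t; lia.
    by move/addnI/val_inj.
  rewrite -[RHS](card_ord m) -[RHS](card_imset _ inj); apply: eq_card => x.
  rewrite inE /path_pos !subSS !subn0; apply/idP/imsetP => [/andP[x1 x2]|[t _ ->]].
    have xt : x - i * q < m by lia.
    exists (Ordinal xt) => //; apply/val_inj; rewrite /= inordK; first by lia.
    by have := ltn_ord x; lia.
  by rewrite inordK; have := ltn_ord t; lia.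
rewrite cardsU1 card_imset; last by move=> t t' [].
rewrite card_ord (_ : _ \notin _); first by lia.
by apply/imsetP => -[].
Qed.

(** [(x + q.-1) %/ q] is [x / q] rounded up: the joint at [i * q] has depth [i], and the positions
    after it up to the next joint have depth [i.+1]. *)
Definition caterpillar_depth (w : C) : nat :=
  match w with
  | inl x => (x + q.-1) %/ q
  | inr (p, _) => (((tag p : path_vertex m d) + q.-1) %/ q).+1
  end.

Definition caterpillar_up (w : C) : {set C} :=
  match w with inl x => trunk (x.-1 %/ q) | inr (p, _) => leaf p end.

Definition caterpillar_top (e : {set C}) : C :=
  if [pick i : 'I_d | e == trunk i] is Some i then inl (joint i)
  else if [pick p | e == leaf p] is Some p then inl (tag p)
  else inl ord0.

Lemma top_trunk (i : 'I_d) : caterpillar_top (trunk i) = inl (joint i).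
Proof.
rewrite /caterpillar_top; case: pickP => [j /eqP/trunk_inj-> //|/(_ i)].
by rewrite eqxx.
Qed.

Lemma top_leaf p : caterpillar_top (leaf p) = inl (tag p).
Proof.
rewrite /caterpillar_top; case: pickP => [j|_].
  by rewrite eq_sym (negPf (trunk_neq_leaf _ _)).
by case: pickP => [p' /eqP/leaf_inj-> //|/(_ p)]; rewrite eqxx.
Qed.

Lemma ceil_div i x : i * q < x -> x <= i.+1 * q ->
  (x + q.-1) %/ q = i.+1 /\ x.-1 %/ q = i.
Proof.
move=> h1 h2; have q0 := q_gt0.
have -> : x + q.-1 = i.+1 * q + (x - i * q).-1 by lia.
have -> : x.-1 = i * q + (x - i * q).-1 by lia.
rewrite !divnMDl // divn_small ?addn0 //; lia.
Qed.

Lemma ceil_joint i : (i * q + q.-1) %/ q = i.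
Proof. by rewrite divnMDl ?q_gt0 // divn_small ?addn0 // prednK ?q_gt0. Qed.

(** An explicit rooting at v_1, from which connectedness, linearity and the absence of loose cycles
    follow together. *)
Lemma caterpillar_rooting : rooting (inl ord0 : C).
Proof.
apply: (@Rooting _ _ caterpillar_top caterpillar_up caterpillar_depth).
- move=> e /mem_caterpillar_edges[[i ->]|[p ->]].
    rewrite top_trunk inl_trunk (val_joint (ltnW (ltn_ord i))).
    by rewrite leqnn leq_mul2r leqnSn orbT.
  by rewrite top_leaf inl_leaf.
- move=> e w /mem_caterpillar_edges[[i ->]|[p ->]]; rewrite ?top_trunk ?top_leaf.
    case: w => [x|u]; last by rewrite inr_trunk.
    rewrite inl_trunk => /andP[x1 x2] /= xj.
    have {}x1 : i * q < x.
      rewrite ltn_neqAle x1 andbT; apply: contra xj => /eqP ix; apply/eqP; congr inl.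
      by apply/val_inj; rewrite /= (val_joint (ltnW (ltn_ord i))).
    by rewrite (val_joint (ltnW (ltn_ord i))) ceil_joint; have [] := ceil_div x1 x2.
  case: w => [x|[p' t]]; first by rewrite inl_leaf => /eqP->; rewrite eqxx.
  by rewrite inr_leaf => /eqP->.
- move=> e w /mem_caterpillar_edges[[i ->]|[p ->]]; rewrite ?top_trunk ?top_leaf.
    case: w => [x|u]; last by rewrite inr_trunk.
    rewrite inl_trunk => /andP[x1 x2] /= xj.
    have {}x1 : i * q < x.
      rewrite ltn_neqAle x1 andbT; apply: contra xj => /eqP ix; apply/eqP; congr inl.
      by apply/val_inj; rewrite /= (val_joint (ltnW (ltn_ord i))).
    by have [_ ->] := ceil_div x1 x2.
  case: w => [x|[p' t]]; first by rewrite inl_leaf => /eqP->; rewrite eqxx.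
  by rewrite inr_leaf => /eqP->.
- by rewrite /= add0n divn_small // prednK // q_gt0.
- move=> [x|[p t]] wr /=; last exact: leaf_edge.
  have id : x.-1 %/ q < d.
    rewrite ltn_divLR ?q_gt0 //; have := ltn_ord x.
    have : 0 < x.
      by rewrite lt0n; apply: contra wr => /eqP x0; apply/eqP; congr inl; apply/val_inj.
    by lia.
  exact: (trunk_edge (Ordinal id)).
- move=> [x|[p t]] wr /=; last by rewrite inr_leaf.
  have x0 : 0 < x.
    by rewrite lt0n; apply: contra wr => /eqP x0; apply/eqP; congr inl; apply/val_inj.
  rewrite inl_trunk mulSn; have := divn_eq x.-1 q; have := ltn_pmod x.-1 q_gt0.
  by lia.
- move=> [x|[p t]] wr /=; last by rewrite top_leaf.
  have x0 : 0 < x.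
    by rewrite lt0n; apply: contra wr => /eqP x0; apply/eqP; congr inl; apply/val_inj.
  have id : x.-1 %/ q < d.
    by rewrite ltn_divLR ?q_gt0 //; have := ltn_ord x; lia.
  rewrite (top_trunk (Ordinal id)); apply/eqP => -[] /(congr1 val) /=.
  rewrite (val_joint (ltnW id)); have := divn_eq x.-1 q; lia.
Qed.

End Caterpillar.

Section CaterpillarDegrees.
Variables (m d : nat) (c : path_vertex m d -> nat).
Hypothesis m2 : 1 < m.
Hypothesis support : forall x, 0 < c x -> exists2 j, 0 < j < d & x = joint m d j.
Local Notation q := (m - 1).
Local Notation C := (caterpillar c).

Let q0 : 0 < q := q_gt0 m2.

Lemma degree_trunk (x : path_vertex m d) :
  degree (inl x : C) = #|[set i : 'I_d | i * q <= x <= i.+1 * q]| + c x.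
Proof.
rewrite /degree (caterpillar_edge_count m2 (fun e => (inl x : C) \in e)).
congr (_ + _); first by apply: eq_card => i; rewrite !in_set inl_trunk.
have inj : injective (fun t : 'I_(c x) => Tagged (fun x => 'I_(c x)) t).
  by move=> t t' /eqP; rewrite eq_Tagged => /eqP.
rewrite -[RHS](card_ord (c x)) -[RHS](card_imset _ inj).
apply: eq_card => -[y t]; rewrite inE inl_leaf; apply/eqP/imsetP => /= [xy|[t' _ E]].
  by subst y; exists t.
by have := congr1 tag E.
Qed.

Lemma degree_leaf u : degree (inr u : C) = 1.
Proof.
case: u => p t; rewrite /degree (caterpillar_edge_count m2 (fun e => (inr (p, t) : C) \in e)).
rewrite eq_card0; last by move=> i; rewrite inE inr_trunk.
rewrite -[RHS](cards1 p); apply: eq_card => p'; rewrite in_set inr_leaf in_set1.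
by rewrite eq_sym.
Qed.

Lemma trunk_count_joint j : 0 < j < d ->
  #|[set i : 'I_d | i * q <= joint m d j <= i.+1 * q]| = 2.
Proof.
case/andP=> j0 jd; have pd : j.-1 < d by lia.
rewrite (_ : [set _ | _] = [set Ordinal pd; Ordinal jd]).
  by rewrite cards2 -val_eqE /= (_ : j.-1 != j) //; lia.
apply/setP => i; rewrite !inE (val_joint m (ltnW jd)) !leq_mul2r -!val_eqE /= eqn0Ngt q0 /=.
by lia.
Qed.

Lemma trunk_count_le1 (x : path_vertex m d) :
  (forall j, 0 < j < d -> x != joint m d j) ->
  #|[set i : 'I_d | i * q <= x <= i.+1 * q]| <= 1.
Proof.
move=> nx; rewrite leqNgt; apply/negP => /card_gt1P[i [i' []]]; rewrite !inE.
wlog ii : i i' / i < i'.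
  move=> W hi hi' ne; case: (ltngtP i i') => ii.
  - exact: (W i i').
  - by apply: (W i' i) => //; rewrite eq_sym.
  - by case/eqP: ne; apply: val_inj.
move=> /andP[_ xi] /andP[xi' _] _.
have le : i' * q <= i.+1 * q by apply: leq_trans xi.
rewrite leq_mul2r eqn0Ngt q0 /= in le.
have ei : i' = i.+1 :> nat by lia.
have id' := ltn_ord i'.
have := nx i'; rewrite id' ei => /(_ isT)/eqP; apply; apply/val_inj => /=.
by rewrite val_joint -?ei ?(ltnW id') //; apply/eqP; rewrite eqn_leq xi' ei xi.
Qed.

Lemma degree_joint j : 0 < j < d -> degree (inl (joint m d j) : C) = 2 + c (joint m d j).
Proof. by move=> jd; rewrite degree_trunk trunk_count_joint. Qed.

Lemma nonpendant_caterpillar (w : C) :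
  nonpendant w <-> exists2 j, 0 < j < d & w = inl (joint m d j).
Proof.
split=> [|[j jd ->]]; last by rewrite /nonpendant degree_joint.
case: w => [x|u]; last by rewrite /nonpendant degree_leaf.
have [/existsP[j /andP[j0 /eqP xj]] _|none] :=
  boolP [exists j : 'I_d, (0 < j) && (x == joint m d j)].
  by exists j; rewrite ?xj // j0 ltn_ord.
have nx j : 0 < j < d -> x != joint m d j.
  case/andP=> j0 jd; apply: contra none => xj.
  by apply/existsP; exists (Ordinal jd); rewrite j0.
rewrite /nonpendant degree_trunk; case: (posnP (c x)) => [->|/support[j jd xj]].
  by rewrite addn0 ltnNge trunk_count_le1.
by have := nx j jd; rewrite xj eqxx.
Qed.

Lemma joint_trunk i j : i < d -> j <= d ->
  ((inl (joint m d j) : C) \in trunk c i) = (i <= j <= i.+1).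
Proof.
move=> id jd; rewrite inl_trunk val_joint // !leq_mul2r eqn0Ngt q0 /=.
by [].
Qed.

Lemma joint_inj i j : i <= d -> j <= d -> joint m d i = joint m d j -> i = j.
Proof.
move=> id jd /(congr1 (@nat_of_ord _)); rewrite !val_joint //.
by move/eqP; rewrite eqn_pmul2r // => /eqP.
Qed.

Lemma caterpillar_two_nonpendant e :
  e \in edges C -> #|[set w in e | nonpendant w]| <= 2.
Proof.
case/mem_caterpillar_edges => [[i ->]|[p ->]].
  have id := ltn_ord i.
  have : [set w in trunk c i | nonpendant w] \subset
      [set inl (joint m d i); inl (joint m d i.+1)].
    apply/subsetP => w; rewrite inE => /andP[wi /nonpendant_caterpillar[j /andP[j0 jd] wj]].
    move: wi; rewrite wj joint_trunk ?(ltnW jd) // => ij; rewrite !inE.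
    by have [->|->] : j = i \/ j = i.+1 by [lia| |]; rewrite eqxx ?orbT.
  by move/subset_leq_card/leq_trans; apply; rewrite cards2; case: (_ != _).
have : [set w in (@pendant_edge m (loose_path m d) c p : {set C}) | nonpendant w]
    \subset [set inl (tag p)].
  apply/subsetP => w; rewrite inE => /andP[wp /nonpendant_caterpillar[j jd wj]].
  by move: wp; rewrite wj inl_leaf inE => /eqP->.
by move/subset_leq_card/leq_trans; apply; rewrite cards1.
Qed.

Lemma adjacent_joint i j : 0 < i < d -> 0 < j < d ->
  adjacent (inl (joint m d i) : C) (inl (joint m d j)) = (i.+1 == j) || (j.+1 == i).
Proof.
move=> /andP[i0 id] /andP[j0 jd]; apply/adjacentP/orP.
  case=> e [ne eE ie je]; case/mem_caterpillar_edges: eE ie je => [[k ->]|[p ->]].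
    rewrite !joint_trunk ?(ltnW id) ?(ltnW jd) // => ik jk.
    have : i <> j by move=> E; rewrite E eqxx in ne.
    by lia.
  by rewrite !inl_leaf => /eqP ip /eqP jp; rewrite ip jp eqxx in ne.
have ne : i <> j -> (inl (joint m d i) : C) != inl (joint m d j).
  by move=> ij; apply/eqP => -[] /(joint_inj (ltnW id) (ltnW jd)).
move=> ij; have {}ne := ne ltac:(by case: ij => /eqP; lia).
case: ij => /eqP E; [exists (trunk c i)|exists (trunk c j)].
  split=> //; first exact: (trunk_edge c (Ordinal id)).
  - by rewrite joint_trunk ?(ltnW id) // leqnn leqnSn.
  - by rewrite joint_trunk ?(ltnW jd) // -E leqnn leqnSn.
split=> //; first exact: (trunk_edge c (Ordinal jd)).
- by rewrite joint_trunk ?(ltnW id) // -E leqnn leqnSn.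
- by rewrite joint_trunk ?(ltnW jd) // leqnn leqnSn.
Qed.

Lemma caterpillar_hypertree : hypertree C.
Proof.
have T := caterpillar_rooting c m2; split.
- exact: rooting_connected T.
- exact: rooting_linear T.
- exact: rooting_acyclic T.
- exact: caterpillar_two_nonpendant.
Qed.

End CaterpillarDegrees.

Definition path_adj (i j : nat) : bool := (i.+1 == j) || (j.+1 == i).

Section Td.
Variables (m d : nat) (c : nat -> nat).
Hypothesis m2 : 1 < m.

Let weight (x : path_vertex m d) := \sum_(2 <= i < d.+1 | path_pos m i == x) c i.

Let path_pos_eq i j : 2 <= i -> j <= d -> (path_pos m i == joint m d j) = (i == j.+1).
Proof.
move=> i2 jd; rewrite val_joint // /path_pos eqn_pmul2r ?subn_gt0 //.
by apply/eqP/eqP; lia.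
Qed.

Let weight_joint j : 0 < j < d -> weight (joint m d j) = c j.+1.
Proof.
case/andP=> j0 jd; rewrite /weight big_seq_cond.
rewrite (eq_bigl (fun i => (i \in index_iota 2 d.+1) && (i == j.+1))); last first.
  move=> i; apply: andb_id2l; rewrite mem_index_iota => /andP[i2 _].
  by rewrite path_pos_eq // ltnW.
rewrite -big_seq_cond -big_filter filter_pred1_uniq ?iota_uniq //.
  by rewrite big_seq1.
by rewrite mem_index_iota; lia.
Qed.

Let weight_support x : 0 < weight x -> exists2 j, 0 < j < d & x = joint m d j.
Proof.
move=> wx; have [/existsP[j /andP[j0 /eqP xj]]|none] :=
  boolP [exists j : 'I_d, (0 < j) && (x == joint m d j)].
  by exists j; rewrite ?xj // j0 ltn_ord.
move: wx; rewrite /weight big_seq_cond big1 // => i /andP[].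
rewrite mem_index_iota => /andP[i2 id] /eqP px; case/negP: none.
have jd : i.-1 < d by lia.
apply/existsP; exists (Ordinal jd); apply/andP; split; first by rewrite /=; lia.
by apply/eqP/val_inj; rewrite /= val_joint ?(ltnW jd) // -px /path_pos subn1.
Qed.

Lemma Td_hypertree : hypertree (Td m d c).
Proof. exact: (caterpillar_hypertree m2 weight_support). Qed.

Lemma Td_uniform : uniform_hypergraph (Td m d c) m.
Proof. exact: (caterpillar_uniform m2). Qed.

Lemma Td_card_edges : #|edges (Td m d c)| = d + \sum_(2 <= i < d.+1) c i.
Proof.
rewrite (caterpillar_edges_card weight m2); congr (_ + _).
rewrite /weight (exchange_big_dep xpredT) //= [LHS]big_seq_cond [RHS]big_seq_cond.
apply: eq_bigr => i; rewrite mem_index_iota andbT => /andP[i2 id].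
rewrite (big_pred1 (joint m d i.-1)) // => x /=.
apply/eqP/eqP => [px|->]; last by apply/eqP; rewrite path_pos_eq; lia.
by apply/val_inj; rewrite /= val_joint -?px /path_pos ?subn1 //; lia.
Qed.

Lemma Td_profile : has_profile (Td m d c) [seq 2 + c i | i <- iota 2 d.-1] path_adj.
Proof.
have sz : size [seq 2 + c i | i <- iota 2 d.-1] = d.-1 by rewrite size_map size_iota.
set ds := [seq _ | _ <- _] in sz *.
have ids (i : 'I_(size ds)) : 0 < i.+1 < d by have := ltn_ord i; rewrite {2}sz; lia.
exists (fun i => inl (joint m d i.+1) : caterpillar weight); split.
- move=> i j [] /(joint_inj m2); have := ids i; have := ids j => /andP[_ jd] /andP[_ id].
  by move=> /(_ (ltnW id) (ltnW jd)) [] /val_inj.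
- move=> x; apply/idP/codomP => [/(nonpendant_caterpillar m2 weight_support)|].
    case=> -[|j] // jd ->; have js : j < size ds by rewrite sz; lia.
    by exists (Ordinal js).
  by case=> i ->; apply/(nonpendant_caterpillar m2 weight_support); exists i.+1.
- move=> i; have is_ : i < d.-1 by have := ltn_ord i; rewrite {2}sz.
  rewrite [LHS](degree_joint weight m2 (ids i)) weight_joint // /ds.
  by rewrite (nth_map 0) ?size_iota // nth_iota.
- by move=> i j; rewrite (adjacent_joint _ m2 (ids i) (ids j)) !eqSS.
Qed.

End Td.

(** * Load of the root in terms of the shape *)

Section TreeShape.
Variables (H : hypergraph) (r : H) (T : rooting r).
Hypothesis root_nonpendant : nonpendant r.
Hypothesis two_nonpendant :
  forall e, e \in edges H -> #|[set v in e | nonpendant v]| <= 2.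
Local Notation p := (parent T).

Lemma parent_adjacent w : w != r -> adjacent w (p w).
Proof.
move=> wr; apply/adjacentP; exists (up T w); split.
- exact: top_up_neq.
- exact: up_edge.
- exact: in_up.
- by apply: top_in; apply: up_edge.
Qed.

Lemma parent_neq w : w != r -> p w != w.
Proof. by move=> wr; rewrite eq_sym; apply: top_up_neq. Qed.

Lemma parent_of_root_nbr w : adjacent w r -> p w = r.
Proof.
case/adjacentP=> e [wr eE we re]; have te := top_root T eE re.
by rewrite /parent (up_below eE we) te.
Qed.

Lemma parent_nonpendant w : w != r -> nonpendant (p w).
Proof. by move=> wr; apply: top_nonpendant => //; apply: up_edge. Qed.

Lemma parent_not_sym u w : u != r -> w != r -> p u = w -> p w != u.
Proof.
move=> ur wr pu; apply/eqP => pw.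
have := depth_parent T ur; have := depth_parent T wr; rewrite pu pw.
by move=> -> /eqP; rewrite -[X in X == _]addn0 -addn2 eqn_add2l.
Qed.

(** Two nonpendant vertices of an edge cannot both lie below its top, so one is the parent of the
    other. *)
Lemma adjacent_nonpendant u w : u != w -> nonpendant u -> nonpendant w ->
  adjacent u w = (u != r) && (p u == w) || (w != r) && (p w == u).
Proof.
move=> uw un wn; apply/idP/orP.
  case/adjacentP=> e [_ eE ue we].
  have [ut|ut] := eqVneq u (top T e).
    have wt : w != top T e by rewrite -ut eq_sym.
    by right; rewrite (below_neq_root eE we wt) /parent (up_below eE we wt) ut eqxx.
  have [wt|wt] := eqVneq w (top T e).
    by left; rewrite (below_neq_root eE ue ut) /parent (up_below eE ue ut) wt eqxx.
  case/eqP: uw; apply: (@nonpendant_below_unique _ _ T root_nonpendant two_nonpendant e) => //.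
    by rewrite !inE ut.
  by rewrite !inE wt.
case=> /andP[xr /eqP <-]; first exact: parent_adjacent.
by rewrite adjacent_sym; apply: parent_adjacent.
Qed.

Section Enumeration.
Variable s : seq H.
Hypothesis s_uniq : uniq s.
Hypothesis sP : forall w, (w \in s) = (w != r) && nonpendant w.

Lemma enum_parent w : w != r -> p w \in r :: s.
Proof.
move=> wr; rewrite inE sP parent_nonpendant // andbT.
by case: eqP.
Qed.

Lemma sum_children_enum : degree r + \sum_(w <- s) children T w = #|edges H|.
Proof.
rewrite -(sum_children T) (bigD1 r) //= (degree_children T r) eqxx add0n.
congr (_ + _); rewrite big_uniq //= [RHS](bigID (mem s)) /=.
rewrite [X in _ = _ + X]big1 ?addn0.
  by apply: eq_bigl => w; rewrite sP; case: (w != r).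
move=> w /andP[wr]; rewrite sP wr /= => wp.
by rewrite (children_pendant T wr wp).
Qed.

Lemma children_enum_gt0 w : w \in s -> 0 < children T w.
Proof.
rewrite sP => /andP[wr]; rewrite /nonpendant (degree_children T) wr.
by case: (children T w).
Qed.

Lemma load_enum (S : pzSemiRingType) (g : S -> S) l v : is_load T g l -> g 0%R = 0%R ->
  (l v = (children T v)%:R + \sum_(w <- s | p w == v) g (l w))%R.
Proof.
move=> lP g0; rewrite (loadE v lP); congr (_ + _)%R.
rewrite -(big_filter s) big_uniq ?filter_uniq // (bigID (mem s)) /=.
rewrite [X in (_ + X)%R]big1 ?addr0.
  apply: eq_bigl => w; rewrite mem_filter sP.
  by case: (w != r); rewrite /= ?andbF ?andbT.
move=> w /andP[/andP[wr _]]; rewrite sP wr /= => wp.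
by rewrite (load_pendant root_nonpendant lP wr wp).
Qed.

End Enumeration.

End TreeShape.

(** * A priori bounds on loads *)

Section LoadBounds.
Variables (R : realType) (H : hypergraph) (r : H) (T : rooting r).
Variables (q : nat) (s : R) (l : H -> R).
Local Open Scope ring_scope.
Local Notation Q := (q%:R : R).
Local Notation g := (gain Q s).
Local Notation k := (#|edges H|%:R : R).
Hypothesis two_nonpendant :
  forall e, e \in edges H -> (#|[set v in e | nonpendant v]| <= 2)%N.
Hypothesis q0 : (0 < q)%N.
Hypothesis s7 : 7 <= s.
Hypothesis lP : is_load T g l.
Hypothesis crit : k - 3 <= critical_load Q s.

Let Q0 : 0 < Q. Proof. by rewrite ltr0n. Qed.
Let s0 : 0 < s. Proof. by move: (s7) => s7'; lra. Qed.

(** From the leaves upwards: the counts [n w] are at most [k - 5], below [critical_load - 1], and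
    there the gain is at most the identity, so a load never exceeds its count. *)
Lemma load_size_bound n : (5 <= degree r)%N -> is_load T id n ->
  forall w, w != r -> [/\ 0 <= l w, l w <= n w & n w <= k - (degree r)%:R].
Proof.
move=> D5 nP; have D5' : 5 <= (degree r)%:R :> R by rewrite ler_nat.
have nk w : w != r -> n w <= k - (degree r)%:R.
  by move=> wr; rewrite lerBrDl; apply: size_below nP _ wr.
apply: (@rooting_ind _ _ T) => v IH vr; split; last exact: nk.
  rewrite (loadE v lP) addr_ge0 // sumr_ge0 // => w /andP[wr /eqP wv].
  have [l0 ln nw] := IH w wr wv wr; apply: gain_ge0 => //.
  have := kappa_critical Q0 s0; have K0 := kappa_gt0 Q0 s0.
  have : kappa Q s * l w <= kappa Q s * (critical_load Q s - 1).
    by rewrite ler_pM2l //; move: (crit) => crit'; lra.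
  by lra.
rewrite (loadE v lP) (loadE v nP) lerD2l; apply: ler_sum => w /andP[wr /eqP wv].
have [l0 ln nw] := IH w wr wv wr; apply: (le_trans _ ln); apply: gain_le_self => //.
by move: (crit) => crit'; lra.
Qed.

Lemma load_admissible : (5 <= degree r)%N ->
  forall w, w != r -> 0 <= l w /\ kappa Q s * l w < s ^+ 2.
Proof.
move=> D5 w wr; have [n nP] := load_exists T (id : R -> R).
have [l0 ln nw] := load_size_bound D5 nP wr; split=> //.
have D5' : 5 <= (degree r)%:R :> R by rewrite ler_nat.
have := kappa_critical Q0 s0; have K0 := kappa_gt0 Q0 s0.
have : kappa Q s * l w <= kappa Q s * (critical_load Q s - 1).
  by rewrite ler_pM2l //; move: (crit) => crit'; lra.
by lra.
Qed.

Lemma load_le3 : (5 <= degree r)%N -> (#|edges H| <= degree r + 3)%N ->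
  forall w, w != r -> l w <= 3.
Proof.
move=> D5 kD w wr; have [n nP] := load_exists T (id : R -> R).
have [l0 ln nw] := load_size_bound D5 nP wr.
have : k <= (degree r)%:R + 3 by rewrite -natrD ler_nat.
by lra.
Qed.

Lemma load_root_large_degree : (5 <= degree r)%N -> (degree r + 4 <= #|edges H|)%N ->
  critical_load Q s = k - 3 + g 1 + g 2 -> l r < critical_load Q s.
Proof.
move=> D5 kD critE; have [n nP] := load_exists T (id : R -> R).
have bnd := load_size_bound D5 nP.
have D5' : 5 <= (degree r)%:R :> R by rewrite ler_nat.
have kD' : (degree r)%:R + 4 <= k by rewrite -natrD ler_nat.
have chD : (children T r)%:R = (degree r)%:R :> R.
  by rewrite (degree_children T r) eqxx.
have nr : \sum_(w | (w != r) && (parent T w == r)) n w = k - (degree r)%:R.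
  by rewrite -(size_root nP) (loadE r nP) chD addrAC subrr add0r.
have KN : kappa Q s * (k - (degree r)%:R) < s ^+ 2.
  have := kappa_critical Q0 s0; have K0 := kappa_gt0 Q0 s0.
  have : kappa Q s * (k - (degree r)%:R) <= kappa Q s * (critical_load Q s - 1).
    by rewrite ler_pM2l //; move: (crit) => crit'; lra.
  by lra.
apply: le_lt_trans (double_broom_load (D := (degree r)%:R)
  (N := k - (degree r)%:R) Q0 s0 s7 _ _ _) => //.
- rewrite (loadE r lP) chD lerD2l.
  have -> : g (k - (degree r)%:R) = g (\sum_(w | (w != r) && (parent T w == r)) n w).
    by rewrite nr.
  apply: le_trans (gain_sum_le (B := k - (degree r)%:R) Q0 s0 _ _ _) => //; last 2 first.
  + by move=> w /andP[wr _]; have [l0 ln _] := bnd w wr; apply: le_trans ln.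
  + by rewrite nr.
  apply: ler_sum => w /andP[wr _]; have [l0 ln nw] := bnd w wr.
  apply: gain_le => //; apply: le_lt_trans KN.
  by rewrite ler_pM2l // kappa_gt0.
- by lra.
- by rewrite critE; lra.
Qed.

Section BoundedDegree.
Hypothesis root_nonpendant : nonpendant r.
Hypothesis degree4 : forall v : H, (degree v <= 4)%N.
Hypothesis k11 : (11 <= #|edges H|)%N.

(** A child edge has at most one lower vertex with nonzero load, whose gain is at most 1 / 3. *)
Let load_sum_le v : (forall w, w != r -> parent T w = v -> 0 <= l w <= 4) ->
  0 <= l v <= 4 / 3 * (children T v)%:R.
Proof.
move=> IH; rewrite lP.
have term e : e \in edges H -> top T e = v ->
    0 <= \sum_(w in e :\ top T e) g (l w) <= 3^-1.
  move=> eE te; have [[c [ce cn]]|none] := below_cases T eE; last first.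
    rewrite big1 => [|w we]; first by apply/andP; split=> //; lra.
    have wr : w != r by move: we; rewrite !inE => /andP[wt we]; apply: below_neq_root eE we wt.
    by rewrite (load_pendant root_nonpendant lP wr (none w we)) gain0.
  have in_below w : w \in e :\ top T e -> w != r /\ parent T w = v.
    rewrite !inE => /andP[wt we]; split; first exact: below_neq_root eE we wt.
    by rewrite /parent (up_below eE we wt).
  rewrite (bigD1 c) //= big1 ?addr0; last first.
    move=> w /andP[we wc]; have [wr _] := in_below w we.
    rewrite (load_pendant root_nonpendant lP wr) ?gain0 //.
    apply: contra wc => wn; apply/eqP.
    exact: (nonpendant_below_unique root_nonpendant two_nonpendant eE we ce).
  have [cr cv] := in_below c ce; have /andP[l0 l4] := IH c cr cv.
  by rewrite gain_third ?gain_ge0 ?kappa4.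
apply/andP; split.
  apply: sumr_ge0 => e /andP[eE /eqP te]; have /andP[t0 _] := term e eE te.
  by rewrite addr_ge0.
have -> : 4 / 3 * (children T v)%:R =
    \sum_(e in edges H | top T e == v) (4 / 3 : R).
  rewrite sumr_const -[RHS]mulr_natr; congr (_ * _%:R); apply: eq_card => e.
  by rewrite inE.
apply: ler_sum => e /andP[eE /eqP te]; have /andP[_ t1] := term e eE te.
by lra.
Qed.

Let load_le4 w : w != r -> 0 <= l w <= 4.
Proof.
move: w; apply: (@rooting_ind _ _ T) => v IH vr.
have /andP[l0 lv] : 0 <= l v <= 4 / 3 * (children T v)%:R.
  by apply: load_sum_le => w wr wv; exact: (IH w wr wv wr).
rewrite l0 /= (le_trans lv) //.
have : (children T v)%:R <= 3 :> R.
  by rewrite ler_nat -ltnS -add1n -[1%N](_ : nat_of_bool (v != r) = _) -?degree_children ?vr.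
by lra.
Qed.

Lemma load_admissible_small w : w != r -> 0 <= l w /\ kappa Q s * l w < s ^+ 2.
Proof. by move=> /load_le4/andP[l0 l4]; rewrite kappa4. Qed.

(** Four child edges at the root give at most 16 / 3, below [k - 3 >= 8]. *)
Lemma load_root_small_degree : l r < critical_load Q s.
Proof.
have /andP[_ lr] : 0 <= l r <= 4 / 3 * (children T r)%:R.
  by apply: load_sum_le => w wr _; apply: load_le4.
have c4 : (children T r)%:R <= 4 :> R.
  by rewrite ler_nat; have := degree4 r; rewrite (degree_children T r) eqxx.
have k8 : 11 <= k by rewrite ler_nat.
by move: (crit) => crit'; lra.
Qed.

End BoundedDegree.

End LoadBounds.

(** Matching a list of vertices against a given degree list names all nonpendant vertices at
    once. *)
Lemma has_profileP (H : hypergraph) ds adj :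
  has_profile H ds adj <-> exists s : seq H, [/\ uniq s,
    forall x, nonpendant x = (x \in s), map (@degree H) s = ds
    & forall x0 i j, i < size s -> j < size s ->
        adjacent (nth x0 s i) (nth x0 s j) = adj i j].
Proof.
split=> [[v [vinj vP vdeg vadj]]|[s [s_uniq sP sdeg sadj]]].
  have nthv x0 i (ids : i < size ds) :
      nth x0 [seq v i | i <- enum 'I_(size ds)] i = v (Ordinal ids).
    rewrite (nth_map (Ordinal ids)) ?size_enum_ord //; congr v.
    by apply/val_inj; rewrite /= nth_enum_ord.
  have sz : size [seq v i | i <- enum 'I_(size ds)] = size ds.
    by rewrite size_map size_enum_ord.
  move: [seq v i | i <- enum _] sz nthv (@map_inj_uniq _ _ v vinj (enum 'I_(size ds)))
    (fun x => @mapP _ _ v (enum 'I_(size ds)) x) => t sz nthv tu tP.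
  exists t; split.
  - by rewrite tu enum_uniq.
  - move=> x; rewrite vP; apply/codomP/tP => [[i ->]|[i _ ->]]; last by exists i.
    by exists i; rewrite ?mem_enum.
  - apply: (@eq_from_nth _ 0) => [|i]; rewrite size_map sz // => ids.
    by rewrite (nth_map (v (Ordinal ids))) ?sz // nthv vdeg.
  - by move=> x0 i j; rewrite sz => ids jds; rewrite (nthv x0 i ids) (nthv x0 j jds) vadj.
have sz : size ds = size s by rewrite -sdeg size_map.
exists (fun i => tnth (in_tuple s) (cast_ord sz i)); split.
- move=> i j /eqP; pose x0 := tnth (in_tuple s) (cast_ord sz i).
  rewrite !(tnth_nth x0) /=.
  by rewrite nth_uniq -?sz // => /eqP/val_inj.
- move=> x; rewrite sP; apply/idP/codomP => [xs|[i ->]]; last exact: mem_tnth.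
  have ixs : index x s < size ds by rewrite sz index_mem.
  by exists (Ordinal ixs); rewrite (tnth_nth x) /= nth_index.
- move=> i; pose x0 := tnth (in_tuple s) (cast_ord sz i).
  by rewrite (tnth_nth x0) /= -{2}sdeg (nth_map x0) // -sz.
- move=> i j; pose x0 := tnth (in_tuple s) (cast_ord sz i).
  by rewrite !(tnth_nth x0) /= sadj // -sz.
Qed.

Lemma adjacent_irr (H : hypergraph) (x : H) : adjacent x x = false.
Proof. by rewrite /adjacent eqxx. Qed.

Lemma has_profile1 (H : hypergraph) (x : H) :
  (forall w, nonpendant w = (w \in [:: x])) -> has_profile H [:: degree x] path_adj.
Proof.
move=> xP; apply/has_profileP; exists [:: x]; split=> // x0 [|i] [|j] //= _ _.
exact: adjacent_irr.
Qed.

Lemma has_profile2 (H : hypergraph) (x y : H) : uniq [:: x; y] ->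
  (forall w, nonpendant w = (w \in [:: x; y])) -> adjacent x y ->
  has_profile H [:: degree x; degree y] path_adj.
Proof.
move=> u2 xP xy; apply/has_profileP; exists [:: x; y].
split=> // x0 [|[|i]] [|[|j]] //= _ _; rewrite ?adjacent_irr //.
by rewrite adjacent_sym.
Qed.

Lemma has_profile3 (H : hypergraph) (x y z : H) : uniq [:: x; y; z] ->
  (forall w, nonpendant w = (w \in [:: x; y; z])) ->
  adjacent x y -> adjacent y z -> ~~ adjacent x z ->
  has_profile H [:: degree x; degree y; degree z] path_adj.
Proof.
move=> u3 xP xy yz xz; apply/has_profileP; exists [:: x; y; z].
split=> // x0 [|[|[|i]]] [|[|[|j]]] //= _ _; rewrite ?adjacent_irr //.
- exact: negPf.
- by rewrite adjacent_sym.
- by rewrite adjacent_sym; apply: negPf.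
- by rewrite adjacent_sym.
Qed.

(** * Root loads of hypertrees with a given profile *)

Section RootLoad.
Variables (R : realType) (H : hypergraph) (q : nat).
Local Open Scope ring_scope.
Hypothesis q0 : (0 < q)%N.
Hypothesis tree : hypertree H.
Hypothesis uniform : uniform_hypergraph H q.+1.
Local Notation Q := (q%:R : R).
Local Notation k := (#|edges H|%:R : R).

(** The load is recorded for all [s] at once, because the parameter is chosen only when two
    hypertrees are compared. Degree 5 is what makes the loads below the root admissible. *)
Definition root_load (F : R -> R) : Prop := exists (r : H) (T : rooting r),
  (5 <= degree r)%N /\ forall s l, is_load T (gain Q s) l -> l r = F s.

Let two_nonpendant :
  forall e, e \in edges H -> (#|[set v in e | nonpendant v]| <= 2)%N.
Proof. by have [] := tree. Qed.

Lemma lambda1_root_load F s : root_load F -> 7 <= s ->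
  k - 3 <= critical_load Q s -> F s = critical_load Q s ->
  lambda1 R q.+1 H = (s + Q - 1) / Q.
Proof.
move=> [r [T [D5 lF]]] s7 crit FE; have s0 : 0 < s by lra.
have [l lP] := load_exists T (gain Q s).
have rn : nonpendant r by apply: leq_trans D5.
apply: (lambda1_critical uniform rn two_nonpendant q0 s0 lP).
  exact: load_admissible.
by rewrite (lF s l lP).
Qed.

Lemma lambda1_root_load_lt F s : root_load F -> 7 <= s ->
  k - 3 <= critical_load Q s -> F s < critical_load Q s ->
  lambda1 R q.+1 H < (s + Q - 1) / Q.
Proof.
move=> [r [T [D5 lF]]] s7 crit FE; have s0 : 0 < s by lra.
have [l lP] := load_exists T (gain Q s).
have rn : nonpendant r by apply: leq_trans D5.
apply: (lambda1_subcritical uniform rn two_nonpendant q0 s0 lP).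
  exact: load_admissible.
by rewrite (lF s l lP).
Qed.

Lemma root_load_intro (r : H) (t : seq H) (F : R -> R) :
  (5 <= degree r)%N -> uniq (r :: t) -> (forall x, nonpendant x = (x \in r :: t)) ->
  (forall (T : rooting r) (s : R) (l : H -> R),
     (forall v, l v = (degree v - (v != r)%N)%N%:R +
                      \sum_(w <- t | parent T w == v) gain Q s (l w)) ->
     l r = F s) ->
  root_load F.
Proof.
move=> D5 /andP[rt ut] tP HF; have [T] := hypertree_rooting r tree.
exists r, T; split=> // s l lP; apply: (HF T) => v.
have rn : nonpendant r by apply: leq_trans D5.
rewrite (load_enum rn ut _ v lP); last 2 first.
- by move=> w; rewrite tP inE; case: eqVneq => [->|] //=; apply: negPf.
- by rewrite gain0.
by rewrite (degree_children T v) addKn.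
Qed.

Lemma root_load1 D : (5 <= D)%N -> has_profile H [:: D] path_adj ->
  root_load (fun=> D%:R).
Proof.
move=> D5 /has_profileP[[|r [|? ?]] [] // ur rP [rD] _].
apply: (root_load_intro (r := r) (t := [::])); rewrite ?rD // => T s l lE.
by rewrite lE big_nil addr0 eqxx subn0 rD.
Qed.

Lemma root_load2 D e : (5 <= D)%N -> has_profile H [:: D; e.+1] path_adj ->
  root_load (fun s => D%:R + gain Q s e%:R).
Proof.
move=> D5 /has_profileP[[|r [|u [|? ?]]] [] // ur rP [rD uD] adj].
have ru : r != u by move: ur; rewrite /= !inE andbT.
apply: (root_load_intro (r := r) (t := [:: u])); rewrite ?rD // => T s l lE.
have pu : parent T u = r by apply: parent_of_root_nbr; have := adj r 1%N 0%N isT isT.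
rewrite lE big_mkcond big_seq1 pu !eqxx subn0 rD; congr (_ + gain _ _ _).
by rewrite lE big_mkcond big_seq1 pu eq_sym ru (negPf ru) uD subn1 addr0.
Qed.

Lemma root_load3_centre D a b : (5 <= D)%N ->
  has_profile H [:: a.+1; D; b.+1] path_adj ->
  root_load (fun s => D%:R + (gain Q s a%:R + gain Q s b%:R)).
Proof.
move=> D5 /has_profileP[[|u [|r [|w [|? ?]]]] [] // ur rP [uD rD wD] adj].
move: (ur); rewrite /= !inE negb_or andbT => /andP[/andP[nur nuw] nrw].
apply: (root_load_intro (r := r) (t := [:: u; w])); rewrite ?rD //.
- by rewrite /= !inE negb_or eq_sym nur nrw nuw.
- by move=> x; rewrite rP !inE orbCA.
move=> T s l lE.
have pu : parent T u = r by apply: parent_of_root_nbr; have := adj r 0%N 1%N isT isT.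
have pw : parent T w = r by apply: parent_of_root_nbr; have := adj r 2%N 1%N isT isT.
rewrite lE big_mkcond /= !big_cons big_nil pu pw !eqxx subn0 rD addr0.
rewrite (lE u) (lE w) !big_mkcond /= !big_cons !big_nil pu pw nur (eq_sym r u) (negPf nur).
by rewrite (negPf nrw) eq_sym nrw uD wD !subn1 /= !addr0.
Qed.

Lemma root_load3_end D : (5 <= D)%N -> has_profile H [:: D; 2%N; 2%N] path_adj ->
  root_load (fun s => D%:R + gain Q s (1 + gain Q s 1)).
Proof.
move=> D5 /has_profileP[[|r [|u [|w [|? ?]]]] [] // ur rP [rD uD wD] adj].
move: (ur); rewrite /= !inE negb_or andbT => /andP[/andP[nru nrw] nuw].
have wr : w != r by rewrite eq_sym.
apply: (root_load_intro (r := r) (t := [:: u; w])); rewrite ?rD // => T s l lE.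
have rn : nonpendant r by rewrite rP inE eqxx.
have pu : parent T u = r by apply: parent_of_root_nbr; have := adj r 1%N 0%N isT isT.
(* [w] is not adjacent to [r], and a parent is nonpendant, so only [u] is left. *)
have pw : parent T w = u.
  have := parent_nonpendant T rn wr; rewrite rP !inE.
  rewrite (negPf (parent_neq T wr)) orbF => /orP[/eqP pw|/eqP //].
  by have := parent_adjacent T wr; rewrite pw (adj r 2%N 0%N isT isT).
rewrite lE big_mkcond /= !big_cons big_nil pu pw !eqxx subn0 rD eq_sym (negPf nru) !addr0.
congr (_ + gain _ _ _).
rewrite lE big_mkcond /= !big_cons big_nil pu pw !eqxx (negPf nru) eq_sym nru uD.
rewrite add0r addr0 subn1; congr (_ + gain _ _ _).
by rewrite lE big_mkcond /= !big_cons big_nil pu pw (negPf nrw) wr (negPf nuw) wD subn1 !addr0.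
Qed.

End RootLoad.

(** * Shapes with three edges off the root that fall below the seven *)

Section Classification.
Variables (R : realType) (H : hypergraph) (q : nat) (s : R).
Variables (r : H) (T : rooting r) (l : H -> R).
Local Open Scope ring_scope.
Local Notation Q := (q%:R : R).
Local Notation k := (#|edges H|).
Local Notation g := (gain Q s).
Local Notation p := (parent T).
Hypothesis q0 : (0 < q)%N.
Hypothesis two_nonpendant :
  forall e, e \in edges H -> (#|[set v in e | nonpendant v]| <= 2)%N.
Hypothesis s7 : 7 <= s.
Hypothesis lP : is_load T g l.
Hypothesis k11 : (11 <= k)%N.
Hypothesis degree_large : (k <= degree r + 3)%N.
Hypothesis crit : critical_load Q s = k%:R - 3 + g 1 + g 2.

Let Q0 : 0 < Q. Proof. by rewrite ltr0n. Qed.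
Let s0 : 0 < s. Proof. by move: (s7) => s7'; lra. Qed.
Let D5 : (5 <= degree r)%N. Proof. by move: (k11) (degree_large); lia. Qed.
Let rn : nonpendant r. Proof. exact: leq_trans D5. Qed.

Let gain_small t : 0 <= t -> t <= 4 -> 0 <= g t <= 3^-1.
Proof. by move=> t0 t4; rewrite gain_ge0 ?kappa4 // gain_third. Qed.

Let l3 w : w != r -> 0 <= l w <= 3.
Proof.
move=> wr; have [g1a _] := andP (gain_small ler01 (ltac:(lra) : (1 : R) <= 4)).
have [g2a _] := andP (gain_small (ltac:(lra) : (0 : R) <= 2) (ltac:(lra) : (2 : R) <= 4)).
have crit' : k%:R - 3 <= critical_load Q s by rewrite crit; lra.
have [l0 _] := load_admissible q0 s7 lP crit' D5 wr.
by rewrite l0 (load_le3 q0 s7 lP crit' D5 _ wr).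
Qed.

Let g12 : [/\ 0 < g 1, g 1 + g 1 < g 2 & g 2 <= 3^-1].
Proof.
have K4 := @kappa4 R Q s Q0 s0 s7.
split.
- rewrite -[X in X < _](@gain0 R Q s); apply: gain_lt => //; apply: K4; lra.
- rewrite [X in _ < g X](_ : 2 = 1 + 1); last by ring.
  by apply: gainD => //; apply: K4; lra.
- by apply: gain_third => //; lra.
Qed.

(** If only [u] hangs at the root, its load is at most 2 and the root gains at most [g 2]. If only
    [w] does, its load is at most [2 + g 1], and [gain_chain3] applies. *)
Lemma load_two_branches u w : uniq [:: u; w] ->
  (forall x, (x \in [:: u; w]) = (x != r) && nonpendant x) ->
  children T u = 1%N -> children T w = 2%N -> degree r = (k - 3)%N ->
  ~~ ((p u == r) && (p w == r)) -> l r < critical_load Q s.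
Proof.
move=> uw_uniq uwP cu cw dr notboth.
have [ur _] : u != r /\ nonpendant u by apply/andP; rewrite -uwP inE eqxx.
have [wr _] : w != r /\ nonpendant w by apply/andP; rewrite -uwP !inE eqxx orbT.
have lE := load_enum rn uw_uniq uwP _ lP (gain0 Q s).
have [g1p g11 g2s] := g12.
have /andP[lu0 lu3] := l3 ur; have /andP[lw0 lw3] := l3 wr.
have /andP[gu0 gu3] := gain_small lu0 (ltac:(lra) : l u <= 4).
have /andP[gw0 gw3] := gain_small lw0 (ltac:(lra) : l w <= 4).
have K4 := @kappa4 R Q s Q0 s0 s7.
have drR : (degree r)%:R = k%:R - 3 :> R by rewrite dr natrB // (leq_trans _ k11).
have lr := lE r; have lu := lE u; have lw := lE w.
rewrite (_ : (children T r)%:R = k%:R - 3) in lr; last first.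
  by rewrite -drR (degree_children T r) eqxx.
rewrite cu in lu; rewrite cw in lw.
rewrite !big_mkcond /= !big_cons !big_nil !addr0 in lr lu lw.
rewrite (negPf (parent_neq T ur)) in lu; rewrite (negPf (parent_neq T wr)) in lw.
rewrite crit; have [pu|pu] := eqVneq (p u) r; have [pw|pw] := eqVneq (p w) r.
- by rewrite pu pw !eqxx in notboth.
- rewrite pu eqxx (negPf pw) in lr.
  have lu2 : l u <= 2 by move: lu; case: ifP => _; lra.
  have : g (l u) <= g 2 by apply: gain_le => //; apply: K4; lra.
  by rewrite lr; lra.
- rewrite pw eqxx (negPf pu) in lr; rewrite pw eq_sym (negPf ur) in lu.
  have lu1 : l u = 1 by lra.
  have lw2 : l w <= 2 + g 1 by move: lw; rewrite lu1; case: ifP => _; lra.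
  have : g (l w) <= g (2 + g 1) by apply: gain_le => //; apply: K4; lra.
  by have := gain_chain3 Q0 s0 s7; rewrite lr; lra.
- by rewrite (negPf pu) (negPf pw) in lr; rewrite lr; lra.
Qed.

(** Each load is 1 plus at most two gains of at most 1 / 3, so a branch at the root gains less than
    [g 2]. With two branches at the root, one of them carries nothing further and gains [g 1]; with
    three, all gain [g 1], and [g 1 + g 1 < g 2]. *)
Lemma load_three_branches u w x : uniq [:: u; w; x] ->
  (forall y, (y \in [:: u; w; x]) = (y != r) && nonpendant y) ->
  children T u = 1%N -> children T w = 1%N -> children T x = 1%N ->
  degree r = (k - 3)%N -> l r < critical_load Q s.
Proof.
move=> uwx_uniq uwxP cu cw cx dr.
have [ur _] : u != r /\ nonpendant u by apply/andP; rewrite -uwxP inE eqxx.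
have [wr _] : w != r /\ nonpendant w by apply/andP; rewrite -uwxP !inE eqxx orbT.
have [xr _] : x != r /\ nonpendant x by apply/andP; rewrite -uwxP !inE eqxx !orbT.
have lE := load_enum rn uwx_uniq uwxP _ lP (gain0 Q s).
have [g1p g11 g2s] := g12.
have /andP[lu0 lu3] := l3 ur; have /andP[lw0 lw3] := l3 wr; have /andP[lx0 lx3] := l3 xr.
have /andP[gu0 gu3] := gain_small lu0 (ltac:(lra) : l u <= 4).
have /andP[gw0 gw3] := gain_small lw0 (ltac:(lra) : l w <= 4).
have /andP[gx0 gx3] := gain_small lx0 (ltac:(lra) : l x <= 4).
have K4 := @kappa4 R Q s Q0 s0 s7.
have drR : (degree r)%:R = k%:R - 3 :> R by rewrite dr natrB // (leq_trans _ k11).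
have lr := lE r; have lu := lE u; have lw := lE w; have lx := lE x.
rewrite (_ : (children T r)%:R = k%:R - 3) in lr; last first.
  by rewrite -drR (degree_children T r) eqxx.
rewrite cu in lu; rewrite cw in lw; rewrite cx in lx.
rewrite !big_mkcond /= !big_cons !big_nil !addr0 in lr lu lw lx.
rewrite (negPf (parent_neq T ur)) in lu; rewrite (negPf (parent_neq T wr)) in lw.
rewrite (negPf (parent_neq T xr)) in lx.
have lt2 y : 0 <= l y -> l y < 2 -> g (l y) < g 2.
  by move=> y0 y2; apply: gain_lt => //; apply: K4; lra.
have gu : g (l u) < g 2 by apply: lt2 => //; move: lu; do 2 case: ifP => _; lra.
have gw : g (l w) < g 2 by apply: lt2 => //; move: lw; do 2 case: ifP => _; lra.
have gx : g (l x) < g 2 by apply: lt2 => //; move: lx; do 2 case: ifP => _; lra.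
rewrite crit lr.
have one y : l y = 1 -> g (l y) = g 1 by move->.
have far y z : y != r -> p z = r -> (p z == y) = false.
  by move=> yr ->; rewrite eq_sym; apply: negPf.
have [pu|pu] := eqVneq (p u) r; have [pw|pw] := eqVneq (p w) r;
  have [px|px] := eqVneq (p x) r; try lra.
- rewrite (far _ _ ur pw) (far _ _ ur px) in lu.
  rewrite (far _ _ wr pu) (far _ _ wr px) in lw.
  rewrite (far _ _ xr pu) (far _ _ xr pw) in lx.
  by rewrite !one; lra.
- rewrite (far _ _ ur pw) in lu; rewrite (far _ _ wr pu) in lw.
  have [xu|xu] := eqVneq (p x) u; last by rewrite (negPf xu) in lu; rewrite (one u); lra.
  have uw : u != w by move: uwx_uniq; rewrite /= !inE negb_or => /andP[/andP[]].
  by rewrite xu (negPf uw) in lw; rewrite (one w); lra.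
- rewrite (far _ _ ur px) in lu; rewrite (far _ _ xr pu) in lx.
  have [wu|wu] := eqVneq (p w) u; last by rewrite (negPf wu) in lu; rewrite (one u); lra.
  have ux : u != x by move: uwx_uniq; rewrite /= !inE negb_or => /andP[/andP[]].
  by rewrite wu (negPf ux) in lx; rewrite (one x); lra.
- rewrite (far _ _ wr px) in lw; rewrite (far _ _ xr pw) in lx.
  have [uw|uw] := eqVneq (p u) w; last by rewrite (negPf uw) in lw; rewrite (one w); lra.
  have wx : w != x by move: uwx_uniq; rewrite /= !inE !andbT => /andP[].
  by rewrite uw (negPf wx) in lx; rewrite (one x); lra.
Qed.

End Classification.

(** * Hypertrees with a vertex of large degree *)

Section RootedProfiles.
Variables (H : hypergraph) (r : H) (T : rooting r).
Hypothesis rn : nonpendant r.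
Hypothesis two_nonpendant :
  forall e, e \in edges H -> #|[set v in e | nonpendant v]| <= 2.
Local Notation p := (parent T).

Let nonpendant_cons t : (forall x, (x \in t) = (x != r) && nonpendant x) ->
  forall x, nonpendant x = (x \in r :: t).
Proof.
by move=> tP x; rewrite inE tP; case: eqVneq => [->|] //=.
Qed.

Lemma broom_profile u :
  (forall x, (x \in [:: u]) = (x != r) && nonpendant x) ->
  has_profile H [:: degree r; degree u] path_adj.
Proof.
move=> uP; have /andP[ur un] : (u != r) && nonpendant u by rewrite -uP inE.
apply: has_profile2; last first.
- have := enum_parent T rn uP ur; rewrite !inE (negPf (parent_neq T ur)) orbF.
  by move=> /eqP <-; rewrite adjacent_sym parent_adjacent.
- exact: nonpendant_cons.
- by rewrite /= inE eq_sym ur.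
Qed.

Lemma double_broom_profile u w : u != w ->
  (forall x, (x \in [:: u; w]) = (x != r) && nonpendant x) ->
  p u = r -> p w = r -> has_profile H [:: degree u; degree r; degree w] path_adj.
Proof.
move=> uw uwP pu pw.
have /andP[ur un] : (u != r) && nonpendant u by rewrite -uwP !inE eqxx.
have /andP[wr wn] : (w != r) && nonpendant w by rewrite -uwP !inE eqxx orbT.
apply: has_profile3.
- by rewrite /= !inE negb_or ur uw eq_sym wr.
- by move=> x; rewrite (nonpendant_cons uwP) !inE orbCA.
- by rewrite -pu parent_adjacent.
- by rewrite adjacent_sym -pw parent_adjacent.
- rewrite (adjacent_nonpendant T rn two_nonpendant uw un wn) pu pw.
  by rewrite !(eq_sym r) (negPf wr) (negPf ur) !andbF.
Qed.

Lemma chain_profile u w : u != w ->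
  (forall x, (x \in [:: u; w]) = (x != r) && nonpendant x) ->
  p u = r -> p w = u -> has_profile H [:: degree r; degree u; degree w] path_adj.
Proof.
move=> uw uwP pu pw.
have /andP[ur un] : (u != r) && nonpendant u by rewrite -uwP !inE eqxx.
have /andP[wr wn] : (w != r) && nonpendant w by rewrite -uwP !inE eqxx orbT.
have rw : r != w by rewrite eq_sym.
apply: has_profile3.
- by rewrite /= !inE negb_or (eq_sym r u) ur rw uw.
- exact: nonpendant_cons.
- by rewrite adjacent_sym -pu parent_adjacent.
- by rewrite adjacent_sym -pw parent_adjacent.
- by rewrite (adjacent_nonpendant T rn two_nonpendant rw rn wn) pw eqxx (negPf ur) andbF.
Qed.

Lemma star_profile :
  (forall x, (x \in [::]) = (x != r) && nonpendant x) ->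
  has_profile H [:: degree r] path_adj.
Proof. by move=> rP; apply: has_profile1; apply: nonpendant_cons. Qed.

End RootedProfiles.

(* Degrees of v_2, ..., v_d along the loose path, for the seven hypertrees. *)
Definition seven_profiles k : seq (seq nat) :=
  [:: [:: k]; [:: k - 1; 2]; [:: k - 2; 3]; [:: 2; k - 2; 2]; [:: k - 2; 2; 2];
      [:: k - 3; 4]; [:: 3; k - 3; 2]].

(** The child counts of the nonpendant vertices other than [r] are positive and add up to
    [k - degree r <= 3]. So they form one of the partitions (), (1), (2), (3), (1,1), (1,2),
    (1,1,1), and only the choice of parents remains. *)
Lemma large_degree_cases (R : realType) (H : hypergraph) (q : nat) (s : R)
    (r : H) (T : rooting r) (l : H -> R) : 0 < q ->
  (forall e, e \in edges H -> #|[set v in e | nonpendant v]| <= 2) ->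
  (7 <= s)%R -> is_load T (gain q%:R s) l -> 11 <= #|edges H| ->
  #|edges H| <= degree r + 3 ->
  critical_load q%:R s = (#|edges H|%:R - 3 + gain q%:R s 1 + gain q%:R s 2)%R ->
  (exists2 ds, ds \in seven_profiles #|edges H| & has_profile H ds path_adj) \/
  (l r < critical_load q%:R s)%R.
Proof.
move=> q0 two s7 lP k11 dr crit.
have rn : nonpendant r by apply: (@leq_trans 5) => //; lia.
pose S := enum [pred w | (w != r) && nonpendant w].
have Su : uniq S by apply: enum_uniq.
have SP x : (x \in S) = (x != r) && nonpendant x by rewrite mem_enum.
have total := sum_children_enum T Su SP.
have pos x : x \in S -> 0 < children T x by apply: children_enum_gt0.
have degE x : x \in S -> degree x = (children T x).+1.
  by rewrite SP => /andP[xr _]; rewrite (degree_children T) xr.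
have par x : x \in S -> parent T x \in r :: S /\ parent T x != x.
  rewrite SP => /andP[xr _]; split; last exact: parent_neq.
  exact: (enum_parent T rn SP).
move: S Su SP total pos degE par => [|u [|w [|x [|y S]]]] Su SP total pos degE par.
- left; exists [:: #|edges H|]; first by rewrite /seven_profiles !inE eqxx.
  have -> : #|edges H| = degree r by rewrite -total big_nil addn0.
  exact: star_profile.
- have upos := pos u (mem_head _ _); have udeg := degE u (mem_head _ _).
  rewrite big_seq1 in total; left; exists [:: degree r; degree u].
    have cases :
      (degree r = #|edges H| - 1 /\ children T u = 1) \/
      (degree r = #|edges H| - 2 /\ children T u = 2) \/
      (degree r = #|edges H| - 3 /\ children T u = 3) by clear -upos total dr; lia.
    rewrite udeg /seven_profiles.
    by case: cases => [[-> ->]|[[-> ->]|[-> ->]]]; rewrite !inE eqxx ?orbT.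
  exact: (broom_profile T).
- have uS : u \in [:: u; w] by rewrite inE eqxx.
  have wS : w \in [:: u; w] by rewrite !inE eqxx orbT.
  have uw : u != w by move: Su; rewrite /= inE andbT.
  have wu : w != u by rewrite eq_sym.
  have SP' z : (z \in [:: w; u]) = (z != r) && nonpendant z by rewrite -SP !inE orbC.
  have Su' : uniq [:: w; u] by rewrite /= inE wu.
  have [pu upu] := par u uS; have [pw wpw] := par w wS.
  have {pu}pu : parent T u = r \/ parent T u = w.
    by move: pu; rewrite !inE (negPf upu) => /orP[/eqP|/eqP]; [left|right].
  have {pw}pw : parent T w = r \/ parent T w = u.
    by move: pw; rewrite !inE (negPf wpw) orbF => /orP[/eqP|/eqP]; [left|right].
  have notsym : ~ (parent T u = w /\ parent T w = u).
    have /andP[ur _] : (u != r) && nonpendant u by rewrite -SP.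
    have /andP[wr _] : (w != r) && nonpendant w by rewrite -SP.
    by case=> puw pwu; have := parent_not_sym ur wr puw; rewrite pwu eqxx.
  have upos := pos u uS; have udeg := degE u uS.
  have wpos := pos w wS; have wdeg := degE w wS.
  rewrite !big_cons big_nil addn0 in total.
  have [[dr2 cu cw]|[[dr3 cu cw]|[dr3 cu cw]]] :
      [/\ degree r = #|edges H| - 2, children T u = 1 & children T w = 1] \/
      [/\ degree r = #|edges H| - 3, children T u = 1 & children T w = 2] \/
      [/\ degree r = #|edges H| - 3, children T u = 2 & children T w = 1].
    clear -upos wpos total dr.
    have [h|[h|h]] : children T u + children T w = 2 \/
      (children T u = 1 /\ children T w = 2) \/
      (children T u = 2 /\ children T w = 1) by lia.
    + by left; split; lia.
    + by right; left; split; lia.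
    + by right; right; split; lia.
  + left; case: pu => [pu|pu]; case: pw => [pw|pw].
    * exists [:: degree u; degree r; degree w];
        last exact: (double_broom_profile rn two uw SP pu pw).
      by rewrite udeg wdeg cu cw dr2 /seven_profiles !inE eqxx !orbT.
    * exists [:: degree r; degree u; degree w];
        last exact: (chain_profile rn two uw SP pu pw).
      by rewrite udeg wdeg cu cw dr2 /seven_profiles !inE eqxx !orbT.
    * exists [:: degree r; degree w; degree u];
        last exact: (chain_profile rn two wu SP' pw pu).
      by rewrite udeg wdeg cu cw dr2 /seven_profiles !inE eqxx !orbT.
    * by case: notsym.
  + have [/andP[/eqP pur /eqP pwr]|bad] := boolP ((parent T u == r) && (parent T w == r)).
      left; exists [:: degree w; degree r; degree u];
        last exact: (double_broom_profile rn two wu SP' pwr pur).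
      by rewrite udeg wdeg cu cw dr3 /seven_profiles !inE eqxx !orbT.
    by right; apply: (load_two_branches q0 s7 lP k11 dr crit Su SP cu cw dr3 bad).
  + have [/andP[/eqP pwr /eqP pur]|bad] := boolP ((parent T w == r) && (parent T u == r)).
      left; exists [:: degree u; degree r; degree w];
        last exact: (double_broom_profile rn two uw SP pur pwr).
      by rewrite udeg wdeg cu cw dr3 /seven_profiles !inE eqxx !orbT.
    by right; apply: (load_two_branches q0 s7 lP k11 dr crit Su' SP' cw cu dr3 bad).
- right; have upos : 0 < children T u by apply: pos; rewrite !inE eqxx.
  have wpos : 0 < children T w by apply: pos; rewrite !inE eqxx orbT.
  have xpos : 0 < children T x by apply: pos; rewrite !inE eqxx !orbT.
  rewrite !big_cons big_nil addn0 in total.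
  have [cu cw cx dr3] : [/\ children T u = 1, children T w = 1, children T x = 1
      & degree r = #|edges H| - 3].
    by clear -upos wpos xpos total dr; split; lia.
  exact: (load_three_branches q0 s7 lP k11 dr crit Su SP cu cw cx dr3).
- have upos : 0 < children T u by apply: pos; rewrite !inE eqxx.
  have wpos : 0 < children T w by apply: pos; rewrite !inE eqxx orbT.
  have xpos : 0 < children T x by apply: pos; rewrite !inE eqxx !orbT.
  have ypos : 0 < children T y by apply: pos; rewrite !inE eqxx !orbT.
  rewrite !big_cons in total; clear -upos wpos xpos ypos total dr; lia.
Qed.

Section HypertreeFacts.
Variable H : hypergraph.
Hypothesis tree : hypertree H.

Lemma hypertree_degree_gt0 : 0 < #|edges H| -> forall x : H, 0 < degree x.
Proof.
rewrite card_gt0 => /set0Pn[e eE] x.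
have /set0Pn[y ye] : e != set0.
  by apply/eqP => e0; have := edges_nonempty H; rewrite -e0 eE.
have [->|xy] := eqVneq x y.
  by rewrite card_gt0; apply/set0Pn; exists e; rewrite inE eE.
by have [T] := hypertree_rooting y tree; rewrite (degree_children T) xy.
Qed.

(** If all degrees were at most 1, only the root of a rooting could have child edges, and at most
    one. *)
Lemma hypertree_nonpendant_exists : 1 < #|edges H| -> exists r : H, nonpendant r.
Proof.
move=> k1; have /set0Pn[e eE] : edges H != set0 by rewrite -card_gt0 ltnW.
have /set0Pn[y ye] : e != set0.
  by apply/eqP => e0; have := edges_nonempty H; rewrite -e0 eE.
have [/existsP[r rn]|none] := boolP [exists r : H, nonpendant r]; first by exists r.
have pend (x : H) : degree x <= 1.
  by rewrite leqNgt; apply: contra none => xn; apply/existsP; exists x.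
have [T] := hypertree_rooting y tree.
have := sum_children T; rewrite (bigD1 y) //= big1 => [|x xy].
  have := pend y; rewrite (degree_children T) eqxx => ch kE.
  by move: k1; rewrite -kE addn0 ltnNge ch.
by have := pend x; rewrite (degree_children T) xy; case: (children T x).
Qed.

End HypertreeFacts.

(** * Comparison of spectral radii *)

Section Comparison.
Variables (R : realType) (q k : nat).
Local Open Scope ring_scope.
Import numFieldNormedType.Exports.
Local Notation Q := (q%:R : R).
Hypothesis q0 : (0 < q)%N.
Hypothesis k42 : 42 <= (k%:R - 10) * Q.

Let q1 : 1 <= Q. Proof. by rewrite ler1n. Qed.

(** At a parameter [s] critical for [G], the value [(s + q - 1) / q] is [lambda1] of [G], and the
    smaller load of [H] makes it a strict upper bound there. *)
Lemma lambda1_compare (G H : hypergraph) (F F' : R -> R) :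
  uniform_hypertree q.+1 k G -> uniform_hypertree q.+1 k H ->
  root_load G q F -> root_load H q F' ->
  (forall s : R, 7 <= s -> [/\ (F x @[x --> s] --> F s)%classic,
     k%:R - 3 <= F s, F s <= k%:R & F' s < F s]) ->
  lambda1 R q.+1 H < lambda1 R q.+1 G.
Proof.
move=> [unifG treeG kG] [unifH treeH kH] GF HF' FP.
have [||s s7 Fs] := @critical_solution R Q q1 k%:R F k42.
- by move=> s /FP[].
- by move=> s /FP[_ F1 F2 _]; rewrite F1.
have [_ F1 _ F'F] := FP s s7.
rewrite (lambda1_root_load q0 treeG unifG GF s7) // ?kG -?Fs //.
by apply: (lambda1_root_load_lt q0 treeH unifH HF' s7); rewrite ?kH -?Fs.
Qed.

Lemma lambda1_not_seven (G H : hypergraph) : (11 <= k)%N ->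
  uniform_hypertree q.+1 k G -> uniform_hypertree q.+1 k H ->
  root_load G q (fun s => k%:R - 3 + gain Q s 1 + gain Q s 2) ->
  ~ (exists2 ds, ds \in seven_profiles k & has_profile H ds path_adj) ->
  lambda1 R q.+1 H < lambda1 R q.+1 G.
Proof.
move=> k11 [unifG treeG kG] [unifH treeH kH] GF notseven.
have Q0 : 0 < Q by rewrite ltr0n.
have Fb (s : R) : 7 <= s -> k%:R - 3 <= k%:R - 3 + gain Q s 1 + gain Q s 2 <= k%:R.
  move=> s7; have s0 : 0 < s by lra.
  have := gain_third Q0 s0 s7 (ltac:(lra) : (0 : R) <= 1) (ltac:(lra) : (1 : R) <= 4).
  have := gain_third Q0 s0 s7 (ltac:(lra) : (0 : R) <= 2) (ltac:(lra) : (2 : R) <= 4).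
  have : 0 <= gain Q s 1 by apply: gain_ge0; rewrite ?kappa4 //; lra.
  have : 0 <= gain Q s 2 by apply: gain_ge0; rewrite ?kappa4 //; lra.
  by move=> *; apply/andP; split; lra.
have [|s s7 Fs] := @critical_solution R Q q1 k%:R _ k42 _ Fb.
  move=> s s7; apply: cvgD; first apply: cvgD; first exact: cvg_cst.
    by apply: (@cvg_gain _ _ q1 (fun=> 1)) => //; apply: tame_cst; lra.
  by apply: (@cvg_gain _ _ q1 (fun=> 2)) => //; apply: tame_cst; lra.
have crit : k%:R - 3 <= critical_load Q s by rewrite -Fs; have /andP[] := Fb s s7.
have s0 : 0 < s by lra.
rewrite (lambda1_root_load q0 treeG unifG GF s7) ?kG //.
have two e : e \in edges H -> (#|[set v in e | nonpendant v]| <= 2)%N.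
  by have [_ _ _] := treeH; apply.
have crit' : #|edges H|%:R - 3 <= critical_load Q s by rewrite kH.
have k11' : (11 <= #|edges H|)%N by rewrite kH.
have critE : critical_load Q s = #|edges H|%:R - 3 + gain Q s 1 + gain Q s 2.
  by rewrite kH Fs.
have [/existsP[r r5]|small] := boolP [exists r : H, (4 < degree r)%N].
  have [T] := hypertree_rooting r treeH.
  have [l lP] := load_exists T (gain Q s).
  have rn : nonpendant r by apply: leq_trans r5.
  apply: (lambda1_subcritical unifH rn two q0 s0 lP).
    exact: (load_admissible q0 s7 lP crit').
  have [large|] := leqP #|edges H| (degree r + 3).
    have [[ds]|//] := large_degree_cases q0 two s7 lP k11' large critE.
    by rewrite kH => dsP dsH; case: notseven; exists ds.
  rewrite -addnS => small.
  exact: (load_root_large_degree q0 s7 lP crit' r5 small critE).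
have deg4 (v : H) : (degree v <= 4)%N.
  by rewrite leqNgt; apply: contra small => v5; apply/existsP; exists v.
have [r rn] : exists r : H, nonpendant r.
  by apply: hypertree_nonpendant_exists => //; rewrite kH (leq_trans _ k11).
have [T] := hypertree_rooting r treeH.
have [l lP] := load_exists T (gain Q s).
apply: (lambda1_subcritical unifH rn two q0 s0 lP).
  exact: (load_admissible_small two q0 s7 lP).
exact: (load_root_small_degree two q0 s7 lP crit').
Qed.

End Comparison.

Lemma root_load_ext (R : realType) (H : hypergraph) q (F F' : R -> R) :
  root_load H q F -> (forall s, F s = F' s) -> root_load H q F'.
Proof.
move=> [r [T [D5 lF]]] FF'; exists r, T; split=> // s l lP.
by rewrite -FF'; apply: lF.
Qed.

Section LoadValues.
Variables (R : realType) (q : R).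
Local Open Scope ring_scope.
Import numFieldNormedType.Exports.
Hypothesis q1 : 1 <= q.
Local Notation g := (gain q).

(** What the six comparisons need. Where the integer part of the load drops by 1, the bounds 0 and 1
    / 3 decide; where it stays, third over fourth is [2 g(1) < g(2)], fourth over fifth is
    [gain_chain2], and sixth over seventh is [g(1) + g(2) < g(3)]. *)
Lemma gain_values (s : R) : 7 <= s ->
  [/\ 0 < g s 1 /\ g s 1 + g s 1 < g s 2, g s 1 + g s 2 < g s 3 /\ g s 3 <= 3^-1,
      g s (1 + g s 1) < 2 * g s 1
    & 0 <= g s (1 + g s 1)].
Proof.
move: (q1) => q1' s7; have [q0 s0] : 0 < q /\ 0 < s by split; lra.
have K4 := @kappa4 R q s q0 s0 s7.
have g1 : 0 < g s 1.
  rewrite -[X in X < _](@gain0 R q s); apply: gain_lt => //; apply: K4; lra.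
have g13 : g s 1 <= 3^-1 by apply: gain_third => //; lra.
split=> //.
- split=> //; rewrite [X in _ < g s X](_ : 2 = 1 + 1); last by ring.
  by apply: gainD => //; apply: K4; lra.
- split; last by apply: gain_third => //; lra.
  rewrite [X in _ < g s X](_ : 3 = 1 + 2); last by ring.
  by apply: gainD => //; apply: K4; lra.
- exact: gain_chain2.
- by apply: gain_ge0 => //; [lra|apply: K4; lra].
Qed.

Definition continuous_from7 (F : R -> R) :=
  forall s : R, 7 <= s -> (F x @[x --> s] --> F s)%classic.

Lemma continuous_from7_cst c : continuous_from7 (fun=> c).
Proof. by move=> s _; apply: cvg_cst. Qed.

Lemma continuous_from7D F F' : continuous_from7 F -> continuous_from7 F' ->
  continuous_from7 (fun s => F s + F' s).
Proof. by move=> FC F'C s s7; apply: cvgD; [apply: FC|apply: F'C]. Qed.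

Lemma continuous_from7_gain c : 0 <= c -> c <= 4 -> continuous_from7 (g^~ c).
Proof. by move=> c0 c4 s s7; apply: (@cvg_gain _ _ q1 (fun=> c)) => //; apply: tame_cst. Qed.

Lemma continuous_from7_gain_gain : continuous_from7 (fun s => g s (1 + g s 1)).
Proof.
move=> s s7; apply: (@cvg_gain _ _ q1 (fun s => 1 + g s 1)) => //.
by apply: tame_gain1 => //; lra.
Qed.

End LoadValues.

Section Seven.
Variables (m k : nat).
Hypothesis m2 : 1 < m.
Hypothesis k11 : 11 <= k.

Lemma Td2_uniform_hypertree c : 2 + c 2 = k -> uniform_hypertree m k (Td m 2 c).
Proof.
move=> ck; split; [exact: Td_uniform|exact: Td_hypertree|].
by rewrite Td_card_edges // /index_iota /= !big_cons big_nil addn0.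
Qed.

Lemma Td3_uniform_hypertree c : 3 + c 2 + c 3 = k -> uniform_hypertree m k (Td m 3 c).
Proof.
move=> ck; split; [exact: Td_uniform|exact: Td_hypertree|].
by rewrite Td_card_edges // /index_iota /= !big_cons big_nil addn0 addnA.
Qed.

Lemma Td4_uniform_hypertree c :
  4 + c 2 + c 3 + c 4 = k -> uniform_hypertree m k (Td m 4 c).
Proof.
move=> ck; split; [exact: Td_uniform|exact: Td_hypertree|].
by rewrite Td_card_edges // /index_iota /= !big_cons big_nil addn0 !addnA.
Qed.

Lemma uniform_hypertree_iso (G H : hypergraph) ds :
  uniform_hypertree m k G -> uniform_hypertree m k H ->
  has_profile G ds path_adj -> has_profile H ds path_adj -> isomorphic G H.
Proof.
move=> [unifG treeG kG] [unifH treeH kH]; apply: (@profile_isomorphic G H m) => //.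
- by rewrite kG.
- by apply: hypertree_degree_gt0; rewrite // kG (leq_trans _ k11).
- by apply: hypertree_degree_gt0; rewrite // kH (leq_trans _ k11).
Qed.

End Seven.

Theorem theorem2p3p1 (R : realType) (m k : nat)
    (hm : 2 <= m) (hk : 0 < k) (hkm : 42 <= (k - 10) * (m - 1)) :
  let T1 := Td m 2 [fun _ : nat => 0 with 2 |-> k - 2] in
  let T2 := Td m 3 [fun _ : nat => 0 with 2 |-> k - 3] in
  let T3 := Td m 3 [fun _ : nat => 0 with 2 |-> k - 4, 3 |-> 1] in
  let T4 := Td m 4 [fun _ : nat => 0 with 3 |-> k - 4] in
  let T5 := Td m 4 [fun _ : nat => 0 with 2 |-> k - 4] in
  let T6 := Td m 3 [fun _ : nat => 0 with 2 |-> k - 5, 3 |-> 2] in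
  let T7 := Td m 4 [fun _ : nat => 0 with 2 |-> 1, 3 |-> k - 5] in
  let seven := [:: T1; T2; T3; T4; T5; T6; T7] in
  [/\ [/\ (lambda1 R m T1 > lambda1 R m T2)%R,
          (lambda1 R m T2 > lambda1 R m T3)%R
        & (lambda1 R m T3 > lambda1 R m T4)%R] /\
      [/\ (lambda1 R m T4 > lambda1 R m T5)%R,
          (lambda1 R m T5 > lambda1 R m T6)%R
        & (lambda1 R m T6 > lambda1 R m T7)%R],
      List.Forall (uniform_hypertree m k) seven
    & forall H : hypergraph,
        uniform_hypertree m k H -> ~ List.Exists (isomorphic H) seven ->
        (lambda1 R m H < lambda1 R m T7)%R].
Proof.
move=> T1 T2 T3 T4 T5 T6 T7 seven.
(* Subtraction is truncated: for [k <= 10] the hypothesis would read [42 <= 0]. *)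
have k11 : 11 <= k.
  by rewrite ltnNge; apply/negP => k10; move: hkm; rewrite (eqP k10) mul0n.
case: m hm hkm @T1 @T2 @T3 @T4 @T5 @T6 @T7 @seven => // q hm hkm.
move=> T1 T2 T3 T4 T5 T6 T7 seven; rewrite subSS subn0 in hkm.
have q0 : 0 < q by [].
have H1 : uniform_hypertree q.+1 k T1 by apply: Td2_uniform_hypertree; rewrite //=; lia.
have H2 : uniform_hypertree q.+1 k T2 by apply: Td3_uniform_hypertree; rewrite //=; lia.
have H3 : uniform_hypertree q.+1 k T3 by apply: Td3_uniform_hypertree; rewrite //=; lia.
have H4 : uniform_hypertree q.+1 k T4 by apply: Td4_uniform_hypertree; rewrite //=; lia.
have H5 : uniform_hypertree q.+1 k T5 by apply: Td4_uniform_hypertree; rewrite //=; lia.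
have H6 : uniform_hypertree q.+1 k T6 by apply: Td3_uniform_hypertree; rewrite //=; lia.
have H7 : uniform_hypertree q.+1 k T7 by apply: Td4_uniform_hypertree; rewrite //=; lia.
have P1 : has_profile T1 [:: k] path_adj.
  have := Td_profile 2 [fun _ : nat => 0 with 2 |-> k - 2] hm.
  by rewrite /= subnKC // (leq_trans _ k11).
have P2 : has_profile T2 [:: k - 1; 2] path_adj.
  have := Td_profile 3 [fun _ : nat => 0 with 2 |-> k - 3] hm.
  by rewrite /= (_ : 2 + (k - 3) = k - 1); [|lia].
have P3 : has_profile T3 [:: k - 2; 3] path_adj.
  have := Td_profile 3 [fun _ : nat => 0 with 2 |-> k - 4, 3 |-> 1] hm.
  by rewrite /= (_ : 2 + (k - 4) = k - 2); [|lia].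
have P4 : has_profile T4 [:: 2; k - 2; 2] path_adj.
  have := Td_profile 4 [fun _ : nat => 0 with 3 |-> k - 4] hm.
  by rewrite /= (_ : 2 + (k - 4) = k - 2); [|lia].
have P5 : has_profile T5 [:: k - 2; 2; 2] path_adj.
  have := Td_profile 4 [fun _ : nat => 0 with 2 |-> k - 4] hm.
  by rewrite /= (_ : 2 + (k - 4) = k - 2); [|lia].
have P6 : has_profile T6 [:: k - 3; 4] path_adj.
  have := Td_profile 3 [fun _ : nat => 0 with 2 |-> k - 5, 3 |-> 2] hm.
  by rewrite /= (_ : 2 + (k - 5) = k - 3); [|lia].
have P7 : has_profile T7 [:: 3; k - 3; 2] path_adj.
  have := Td_profile 4 [fun _ : nat => 0 with 2 |-> 1, 3 |-> k - 5] hm.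
  by rewrite /= (_ : 2 + (k - 5) = k - 3); [|lia].
have L1 : root_load T1 q (fun=> k%:R : R)%R.
  by case: H1 => U t _; apply: root_load1 P1 => //; lia.
have L2 : root_load T2 q (fun s : R => k%:R - 1 + gain q%:R s 1)%R.
  case: H2 => U t _; apply: root_load_ext (root_load2 R q t _ P2) _; first by lia.
  by move=> s; rewrite natrB // (leq_trans _ k11).
have L3 : root_load T3 q (fun s : R => k%:R - 2 + gain q%:R s 2)%R.
  case: H3 => U t _; apply: root_load_ext (root_load2 R q t _ P3) _; first by lia.
  by move=> s; rewrite natrB // (leq_trans _ k11).
have L4 : root_load T4 q (fun s : R => k%:R - 2 + (gain q%:R s 1 + gain q%:R s 1))%R.
  case: H4 => U t _; apply: root_load_ext (root_load3_centre R q t _ P4) _; first by lia.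
  by move=> s; rewrite natrB // (leq_trans _ k11).
have L5 : root_load T5 q (fun s : R => k%:R - 2 + gain q%:R s (1 + gain q%:R s 1))%R.
  case: H5 => U t _; apply: root_load_ext (root_load3_end R q t _ P5) _; first by lia.
  by move=> s; rewrite natrB // (leq_trans _ k11).
have L6 : root_load T6 q (fun s : R => k%:R - 3 + gain q%:R s 3)%R.
  case: H6 => U t _; apply: root_load_ext (root_load2 R q t _ P6) _; first by lia.
  by move=> s; rewrite natrB // (leq_trans _ k11).
have L7 : root_load T7 q (fun s : R => k%:R - 3 + gain q%:R s 1 + gain q%:R s 2)%R.
  case: H7 => U t _; apply: root_load_ext (root_load3_centre R q t _ P7) _; first by lia.
  move=> s; rewrite natrB ?(leq_trans _ k11) // -[RHS]addrA; congr (_ + _)%R.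
  exact: addrC.
have k42 : (42 <= (k%:R - 10) * q%:R :> R)%R.
  by rewrite -(natrB _ (ltnW k11)) -natrM ler_nat.
have q1 : (1 <= q%:R :> R)%R by rewrite ler1n.
clear hk hkm.
pose CC (c : R) := @continuous_from7_cst R c.
have Cg (c : R) : (0 <= c)%R -> (c <= 4)%R -> continuous_from7 (fun s => gain q%:R s c).
  exact: (continuous_from7_gain q1).
have C1 : continuous_from7 (fun=> k%:R : R)%R := CC _.
have C2 : continuous_from7 (fun s : R => k%:R - 1 + gain q%:R s 1)%R.
  by apply: continuous_from7D (CC _) (Cg _ _ _) => //; lra.
have C3 : continuous_from7 (fun s : R => k%:R - 2 + gain q%:R s 2)%R.
  by apply: continuous_from7D (CC _) (Cg _ _ _) => //; lra.
have C4 : continuous_from7 (fun s : R => k%:R - 2 + (gain q%:R s 1 + gain q%:R s 1))%R.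
  by apply: continuous_from7D (CC _) (continuous_from7D (Cg _ _ _) (Cg _ _ _)) => //; lra.
have C5 : continuous_from7 (fun s : R => k%:R - 2 + gain q%:R s (1 + gain q%:R s 1))%R.
  exact: continuous_from7D (CC _) (continuous_from7_gain_gain q1).
have C6 : continuous_from7 (fun s : R => k%:R - 3 + gain q%:R s 3)%R.
  by apply: continuous_from7D (CC _) (Cg _ _ _) => //; lra.
split.
- split; split.
  + apply: (lambda1_compare q0 k42 H1 H2 L1 L2) => s s7.
    have [[g1 g2] [g3 g4] g5 g6] := gain_values q1 s7.
    by split; [exact: (C1 s s7)|lra|lra|lra].
  + apply: (lambda1_compare q0 k42 H2 H3 L2 L3) => s s7.
    have [[g1 g2] [g3 g4] g5 g6] := gain_values q1 s7.
    by split; [exact: (C2 s s7)|lra|lra|lra].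
  + apply: (lambda1_compare q0 k42 H3 H4 L3 L4) => s s7.
    have [[g1 g2] [g3 g4] g5 g6] := gain_values q1 s7.
    by split; [exact: (C3 s s7)|lra|lra|lra].
  + apply: (lambda1_compare q0 k42 H4 H5 L4 L5) => s s7.
    have [[g1 g2] [g3 g4] g5 g6] := gain_values q1 s7.
    by split; [exact: (C4 s s7)|lra|lra|lra].
  + apply: (lambda1_compare q0 k42 H5 H6 L5 L6) => s s7.
    have [[g1 g2] [g3 g4] g5 g6] := gain_values q1 s7.
    by split; [exact: (C5 s s7)|lra|lra|lra].
  + apply: (lambda1_compare q0 k42 H6 H7 L6 L7) => s s7.
    have [[g1 g2] [g3 g4] g5 g6] := gain_values q1 s7.
    by split; [exact: (C6 s s7)|lra|lra|lra].
- by do 7 (apply: List.Forall_cons => //).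
- move=> H HH noiso; apply: (lambda1_not_seven q0 k42 k11 H7 HH L7) => -[ds].
  have iso G : uniform_hypertree q.+1 k G -> has_profile G ds path_adj ->
      has_profile H ds path_adj -> isomorphic H G.
    by move=> HG PG PH; apply: (uniform_hypertree_iso k11 HH HG PH PG).
  rewrite /seven_profiles !inE => dsP PH; apply: noiso; rewrite /seven.
  case/or4P: dsP => [/eqP E|/eqP E|/eqP E|/or4P[]/eqP E]; subst ds.
  + by apply: List.Exists_cons_hd; apply: iso.
  + by do 1 (apply: List.Exists_cons_tl); apply: List.Exists_cons_hd; apply: iso.
  + by do 2 (apply: List.Exists_cons_tl); apply: List.Exists_cons_hd; apply: iso.
  + by do 3 (apply: List.Exists_cons_tl); apply: List.Exists_cons_hd; apply: iso.
  + by do 4 (apply: List.Exists_cons_tl); apply: List.Exists_cons_hd; apply: iso.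
  + by do 5 (apply: List.Exists_cons_tl); apply: List.Exists_cons_hd; apply: iso.
  + by do 6 (apply: List.Exists_cons_tl); apply: List.Exists_cons_hd; apply: iso.
Qed.
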